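(* Let $b_0>0$. For $b\in(0,b_0]$ and $f\in H$ put $\Gamma(\eta)=f(\eta)\sqrt{1-\eta^2}$ and define the bending moment (including the wing's own weight) $$M_{b,f}(\xi)=\frac b2\int_\xi^1\Gamma(\eta)\sin\!\Big(\frac{b(\eta-\xi)}{2}\Big)\,d\eta,\qquad \xi\in[0,1].$$ Let $\mathcal{A}_2$ be the set of pairs $(b,f)$ with $b\in(0,b_0]$, $f\in H$, $D[f]<\infty$, satisfying the lift constraint $a_0(f)=\frac{4}{\pi b}$, the weight constraint $$b\int_0^1 |M_{b,f}(\xi)|\,d\xi\le 1,$$ and the non-collapse conditions $$M_{b,f}(\xi)\ge 0\quad\text{and}\quad M_{b,f}(\xi)\ge \frac{b^2}{4}\int_\xi^1 M_{b,f}(\eta)(\eta-\xi)\,d\eta\qquad\text{for all }\xi\in[0,1].$$ Then there exists $(\tilde b,\tilde f)\in\mathcal{A}_2$ with $D[\tilde f]=\min_{(b,f)\in\mathcal{A}_2}D[f]$.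
   Context: All physical and material constants are normalized to $1$. $H$ denotes the real Hilbert space of even measurable functions $f:(-1,1)\to\mathbb{R}$ with $\int_{-1}^1 f(\xi)^2\sqrt{1-\xi^2}\,d\xi<\infty$, with inner product $(f,g)=\int_{-1}^1 fg\sqrt{1-\xi^2}\,d\xi$. $U_n$ is the Chebyshev polynomial of the second kind ($U_0=1$, $U_1=2x$, $U_{n+1}=2xU_n-U_{n-1}$), with $\int_{-1}^1U_nU_m\sqrt{1-x^2}\,dx=\frac\pi2\delta_{nm}$. For $f\in H$, $a_n(f)=\frac{2}{\pi}\int_{-1}^1 fU_n\sqrt{1-\xi^2}\,d\xi$ and the induced drag is $D[f]=\frac{\pi}{8}\sum_{m\ge0}(2m+1)a_{2m}(f)^2\in[0,\infty]$. In physical variables $x=\xi b/2$, $M_{b,f}$ is the unique solution of $M(x)=\int_x^{b/2}(\Gamma(y)-M(y))(y-x)\,dy$, i.e. the lift-induced bending moment reduced by the moment of the wing's own weight (weight per unit span proportional to $M$). *)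

(* Defs.v *)
From HB Require Import structures.
From mathcomp Require Import all_boot all_order all_algebra.
From mathcomp Require Import all_classical all_reals all_analysis.
Set Implicit Arguments. Unset Strict Implicit. Unset Printing Implicit Defensive.
Import Order.TTheory GRing.Theory Num.Theory.
Import numFieldNormedType.Exports.
Local Open Scope classical_set_scope.
Local Open Scope ring_scope.

Section Wing.
Variable R : realType.

Local Notation leb := (@lebesgue_measure R).

Definition I11 : set R := `](-1)%R, 1%R[.

Fixpoint chebU (n : nat) : R -> R :=
  match n with
  | 0%N => fun _ => 1
  | 1%N => fun x => 2 * x
  | (m.+1 as k).+1 => fun x => 2 * x * chebU k x - chebU m x
  end.

Definition wgt (x : R) : R := Num.sqrt (1 - x ^+ 2).

Definition inH (f : R -> R) : Prop :=
  measurable_fun I11 f /\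
  (forall x, (-1 < x < 1)%R -> f (- x) = f x) /\
  (\int[leb]_(x in I11) ((f x) ^+ 2 * wgt x)%:E < +oo)%E.

Definition cheb_coef (f : R -> R) (n : nat) : R :=
  2 / pi * \int[leb]_(x in I11) (f x * chebU n x * wgt x).

Definition drag (f : R -> R) : \bar R :=
  ((pi / 8)%:E * \sum_(0 <= m <oo) (((2 * m + 1)%:R * (cheb_coef f (2 * m)) ^+ 2)%:E))%E.

Definition bmoment (b : R) (f : R -> R) (xi : R) : R :=
  b / 2 * \int[leb]_(eta in `[xi, (1 : R)]) (f eta * wgt eta * sin (b * (eta - xi) / 2)).

Definition A2 (b0 : R) (b : R) (f : R -> R) : Prop :=
  0 < b <= b0 /\ inH f /\ (drag f < +oo)%E /\
  cheb_coef f 0 = 4 / (pi * b) /\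
  b * \int[leb]_(xi in `[(0 : R), 1]) `|bmoment b f xi| <= 1 /\
  (forall xi, 0 <= xi <= 1 ->
     0 <= bmoment b f xi /\
     b ^+ 2 / 4 * \int[leb]_(eta in `[xi, (1 : R)]) (bmoment b f eta * (eta - xi))
       <= bmoment b f xi).

End Wing.

(* Main.v *)
(* Idea.  The bound on the drag controls the coefficients [a_n], and since
   [D >= pi/8 a_0^2 = 2/(pi b^2)] also keeps the span away from [0].  Along a
   minimising sequence the coefficients therefore converge one by one (Tychonoff),
   and the weights [2m+1] in the drag turn this into l^2-convergence; by
   Riesz-Fischer the limits are the coefficients of some [f] in [H].  The moment is the
   pairing of [f] with the kernel [sin (b (x - xi)_+ / 2)].  This kernel is a bounded
   iterated pointwise limit of polynomials, so the pairing is controlled by the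
   coefficients alone (no Parseval identity for [f] is needed), and the moments
   converge pointwise and boundedly.  All constraints thus pass to the limit, and
   the drag is lower semicontinuous.  The admissible set is nonempty because a
   short wing with constant [f] satisfies every constraint. *)
Require Import Defs.
From HB Require Import structures.
From mathcomp Require Import all_boot all_order all_algebra.
From mathcomp Require Import all_classical all_reals all_analysis.
From mathcomp Require Import measurable_realfun ring lra.
Set Implicit Arguments.
Unset Strict Implicit.
Unset Printing Implicit Defensive.
Import Order.TTheory GRing.Theory Num.Theory.
Import numFieldNormedType.Exports.
Local Open Scope classical_set_scope.
Local Open Scope ring_scope.

(** Both the load and the kernel move along the sequence, since the span sits inside the sine. Hence
    the estimate for a load with small coefficients must be uniform over kernels. Parseval would
    give it at the price of completeness of the [U_n] in [H]. The substitute is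
    [2 <f, phi> <= e (|phi|^2 + pi/2)] whenever the squared coefficients of [f] sum to at most
    [e^2]. It holds for Chebyshev sums by AM-GM, and with [e] fixed it survives bounded pointwise
    limits of [phi], so no approximation of [f] is ever made. Applied to the difference of two
    loads, with [|kern| <= 1], it gives the error [e pi/2] whatever the span.

    The spans need no compactness argument of their own: the lift constraint makes [b] a continuous
    function of the zeroth coefficient. The limit load must be an actual function, even at every
    point, so it is built as a pointwise limit of partial sums rather than as an abstract element of
    a completion. *)

Lemma ler_cvg_seq {R : realType} (u v : nat -> R) (l l' : R) :
  u n @[n --> \oo] --> l -> v n @[n --> \oo] --> l' ->
  (forall n, u n <= v n) -> l <= l'.
Proof. by move=> ul vl uv; apply: (ler_cvg_to ul vl); exact: nearW. Qed.

Lemma cvg_seq_le {R : realType} (u : nat -> R) (l B : R) :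
  u n @[n --> \oo] --> l -> (forall n, u n <= B) -> l <= B.
Proof. by move=> ul uB; apply: (ler_cvg_seq ul _ uB); exact: cvg_cst. Qed.

Lemma cvg_seq_ge {R : realType} (u : nat -> R) (l B : R) :
  u n @[n --> \oo] --> l -> (forall n, B <= u n) -> B <= l.
Proof. by move=> ul uB; apply: (ler_cvg_seq _ ul uB); exact: cvg_cst. Qed.

(** * Integration against the weight *)

Section WeightedIntegral.
Context {R : realType}.
Local Notation mu := (@lebesgue_measure R).
Local Notation I := (@I11 R).
Implicit Types (F G f phi : R -> R) (x : R).

Definition wint F : Prop := mu.-integrable I (EFin \o (fun x => F x * wgt x)).
Definition wip F : R := \int[mu]_(x in I) (F x * wgt x).

Lemma measurable_I11 : measurable I.
Proof. exact: measurable_itv. Qed.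
Local Hint Resolve measurable_I11 : core.

Lemma I11P x : I x <-> -1 < x < 1.
Proof. by rewrite /I11 /= in_itv. Qed.

Lemma wgt_ge0 x : 0 <= wgt x.
Proof. exact: sqrtr_ge0. Qed.

Lemma wgt_le1 x : wgt x <= 1.
Proof.
by rewrite /wgt -[leRHS]sqrtr1 ler_wsqrtr// gerBl sqr_ge0.
Qed.

Lemma wgt_gt0 x : I x -> 0 < wgt x.
Proof. by move=> /I11P/andP[a b]; rewrite /wgt sqrtr_gt0; nra. Qed.

Lemma wgtN x : wgt (- x) = wgt x.
Proof. by rewrite /wgt sqrrN. Qed.

Lemma wgt1 : wgt (1 : R) = 0.
Proof. by rewrite /wgt expr1n subrr sqrtr0. Qed.

Lemma continuous_wgt : continuous (@wgt R).
Proof.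
move=> x; apply: (@continuous_comp _ _ _ (fun x : R => 1 - x ^+ 2) Num.sqrt).
  by apply: cvgB; [exact: cvg_cst|exact: exprn_continuous].
exact: sqrt_continuous.
Qed.

Lemma measurable_wgt : measurable_fun I (@wgt R).
Proof.
by apply: measurable_funTS; apply: continuous_measurable_fun; exact: continuous_wgt.
Qed.
Local Hint Resolve measurable_wgt : core.

Lemma integrable_cst (k : R) : mu.-integrable I (EFin \o cst k).
Proof.
apply: (@integrableS _ _ _ mu `[(-1)%R, 1%R]%classic I) => //.
  by move=> x /I11P/andP[a b]; rewrite /= in_itv /=; apply/andP; split; apply: ltW.
apply: continuous_compact_integrable; first exact: segment_compact.
by apply: continuous_subspaceT => x; exact: cvg_cst.
Qed.

Lemma wint_le F G : measurable_fun I F -> (forall x, I x -> `|F x| <= G x) ->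
  wint G -> wint F.
Proof.
move=> mF FG iG; apply: le_integrable iG => //.
  by apply/measurable_EFinP; apply: measurable_funM.
move=> x Ix /=; rewrite lee_fin !normrM; apply: ler_wpM2r; first exact: normr_ge0.
by rewrite (le_trans (FG _ Ix))// ler_norm.
Qed.

Lemma wint_cst (k : R) : wint (cst k).
Proof.
apply: le_integrable (integrable_cst k) => //.
  by apply/measurable_EFinP; apply: measurable_funM.
move=> x Ix /=; rewrite lee_fin normrM ler_piMr// ger0_norm ?wgt_le1 ?wgt_ge0//.
Qed.

Lemma wint_bounded F (B : R) : measurable_fun I F ->
  (forall x, I x -> `|F x| <= B) -> wint F.
Proof. by move=> mF FB; apply: (@wint_le _ (cst B)) => //; exact: wint_cst. Qed.

Lemma eq_wint F G : (forall x, I x -> F x = G x) -> wint F -> wint G.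
Proof.
move=> FG; rewrite /wint; apply: eq_integrable => // x /[!inE] Ix.
by rewrite /= FG.
Qed.

Lemma eq_wip F G : (forall x, I x -> F x = G x) -> wip F = wip G.
Proof. by move=> FG; apply: eq_Rintegral => x /[!inE] Ix; rewrite FG. Qed.

Lemma wintZ (k : R) F : wint F -> wint (fun x => k * F x).
Proof.
move=> iF; rewrite /wint.
have := integrableZl (mu := mu) measurable_I11 k iF; apply: eq_integrable => // x _.
by rewrite /= -EFinM mulrA.
Qed.

Lemma wipZ (k : R) F : wint F -> wip (fun x => k * F x) = k * wip F.
Proof.
move=> iF; rewrite /wip -RintegralZl//.
by apply: eq_Rintegral => x _; rewrite mulrA.
Qed.

Lemma wintD F G : wint F -> wint G -> wint (fun x => F x + G x).
Proof.
move=> iF iG; rewrite /wint.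
have := integrableD (mu := mu) measurable_I11 iF iG; apply: eq_integrable => // x _.
by rewrite /= -EFinD mulrDl.
Qed.

Lemma wipD F G : wint F -> wint G -> wip (fun x => F x + G x) = wip F + wip G.
Proof.
move=> iF iG; rewrite /wip -RintegralD//.
by apply: eq_Rintegral => x _; rewrite mulrDl.
Qed.

Lemma wintN F : wint F -> wint (fun x => - F x).
Proof. by move=> /(wintZ (-1)); apply: eq_wint => x _; rewrite mulN1r. Qed.

Lemma wipN F : wint F -> wip (fun x => - F x) = - wip F.
Proof. by move=> iF; rewrite -mulN1r -wipZ//; apply: eq_wip => x _; rewrite mulN1r. Qed.

Lemma wipB F G : wint F -> wint G -> wip (fun x => F x - G x) = wip F - wip G.
Proof. by move=> iF iG; rewrite wipD ?wipN//; exact: wintN. Qed.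

Lemma wint_sum n (F : nat -> R -> R) : (forall i, wint (F i)) ->
  wint (fun x => \sum_(i < n) F i x).
Proof.
move=> iF; elim: n => [|n ih].
  by apply: eq_wint (wint_cst 0) => x _; rewrite big_ord0.
apply: eq_wint (wintD ih (iF n)) => x _.
by rewrite big_ord_recr.
Qed.

Lemma wip_sum n (F : nat -> R -> R) : (forall i, wint (F i)) ->
  wip (fun x => \sum_(i < n) F i x) = \sum_(i < n) wip (F i).
Proof.
move=> iF; elim: n => [|n ih].
  rewrite big_ord0 -[RHS](mul0r (wip (cst 0))) -wipZ; last exact: (wint_cst 0).
  by apply: eq_wip => x _; rewrite big_ord0 mul0r.
rewrite big_ord_recr /= -ih -wipD//; last exact: wint_sum.
by apply: eq_wip => x _; rewrite big_ord_recr.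
Qed.

Lemma le_wip F G : wint F -> wint G -> (forall x, I x -> F x <= G x) ->
  wip F <= wip G.
Proof.
move=> iF iG FG; apply: le_Rintegral => // x Ix.
by rewrite ler_wpM2r ?wgt_ge0// FG.
Qed.

Lemma wip_ge0 F : (forall x, I x -> 0 <= F x) -> 0 <= wip F.
Proof. by move=> F0; apply: Rintegral_ge0 => x Ix; rewrite mulr_ge0 ?wgt_ge0 ?F0. Qed.

Lemma wint_norm F : wint F -> wint (fun x => `|F x|).
Proof.
move=> /integrable_norm; apply: eq_integrable => // x _.
by rewrite /= normrM (ger0_norm (wgt_ge0 x)).
Qed.

Lemma ae_impl (P Q : R -> Prop) : (forall x, P x -> Q x) ->
  {ae mu, forall x, P x} -> {ae mu, forall x, Q x}.
Proof. by move=> PQ; apply: filterS; first exact: (ae_filter_ringOfSetsType mu). Qed.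

(** The almost-everywhere form serves the Riesz-Fischer construction, where the partial sums are
    controlled only off a null set. *)
Lemma wip_dct_ae (Fn : nat -> R -> R) F G :
  (forall n, measurable_fun I (Fn n)) -> measurable_fun I F -> wint G ->
  {ae mu, forall x, I x -> Fn n x @[n --> \oo] --> F x} ->
  {ae mu, forall x n, I x -> `|Fn n x| <= G x} ->
  wip (Fn n) @[n --> \oo] --> wip F.
Proof.
move=> mFn mF iG cF bF.
have [| | | | |iF _ +] := @dominated_convergence _ _ _ mu I measurable_I11
  (fun n => EFin \o (fun x => Fn n x * wgt x)) (EFin \o (fun x => F x * wgt x))
  (EFin \o (fun x => G x * wgt x)).
- by move=> n; apply/measurable_EFinP; apply: measurable_funM; [exact: mFn|exact: measurable_wgt].
- by apply/measurable_EFinP; apply: measurable_funM; [exact: mF|exact: measurable_wgt].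
- apply: ae_impl cF => x cF Ix; apply: cvg_EFin; first exact: nearW.
  by apply: cvgM; [exact: cF|exact: cvg_cst].
- exact: iG.
- apply: ae_impl bF => x bF n Ix /=; rewrite lee_fin normrM (ger0_norm (wgt_ge0 x)).
  by rewrite ler_wpM2r ?wgt_ge0// bF.
rewrite -(fineK (integrable_fin_num (mu := mu) measurable_I11 iF)) => h.
exact: fine_cvg h.
Qed.

Lemma wip_dct (Fn : nat -> R -> R) F G :
  (forall n, measurable_fun I (Fn n)) -> measurable_fun I F -> wint G ->
  (forall x, I x -> Fn n x @[n --> \oo] --> F x) ->
  (forall x n, I x -> `|Fn n x| <= G x) ->
  wip (Fn n) @[n --> \oo] --> wip F.
Proof. by move=> mFn mF iG cF bF; apply: (@wip_dct_ae _ _ G) => //; exact: aeW. Qed.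

Lemma inHP f : inH f <->
  [/\ measurable_fun I f, forall x, I x -> f (- x) = f x & wint (fun x => f x ^+ 2)].
Proof.
split=> [[mf [ef hf]]|[mf ef hf]].
  split => //.
  apply/integrableP; split.
    by apply/measurable_EFinP; apply: measurable_funM => //; exact: measurable_funX.
  apply: le_lt_trans hf; rewrite le_eqVlt; apply/orP; left.
apply/eqP/eq_integral => x _.
  by rewrite /= ger0_norm// mulr_ge0 ?sqr_ge0 ?wgt_ge0.
split=> //; split; first by move=> x /I11P; exact: ef.
case/integrableP: hf => _; apply: le_lt_trans; rewrite le_eqVlt; apply/orP; left.
apply/eqP/eq_integral => x _.
by rewrite /= ger0_norm// mulr_ge0 ?sqr_ge0 ?wgt_ge0.
Qed.

Lemma inH_measurable f : inH f -> measurable_fun I f.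
Proof. by case/inHP. Qed.

Lemma inH_even f x : inH f -> I x -> f (- x) = f x.
Proof. by case/inHP => _ + _; apply. Qed.

(** The weight has finite mass, so [|f| <= 1 + f^2] suffices in place of Cauchy-Schwarz. *)
Lemma wint_norm_inH f : inH f -> wint (fun x => `|f x|).
Proof.
case/inHP=> mf _ hf; apply: (@wint_le _ (fun x => 1 + f x ^+ 2)).
- by apply: measurableT_comp => //.
- by move=> x _; rewrite normr_id -real_normK ?num_real//; nra.
- by apply: wintD => //; exact: wint_cst.
Qed.

Lemma wint_inHM f phi (B : R) : inH f -> measurable_fun I phi ->
  (forall x, I x -> `|phi x| <= B) -> wint (fun x => f x * phi x).
Proof.
move=> Hf mphi bphi; apply: (@wint_le _ (fun x => B * `|f x|)).
- by apply: measurable_funM => //; exact: inH_measurable.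
- by move=> x Ix; rewrite normrM mulrC ler_wpM2r// bphi.
- by apply: wintZ; exact: wint_norm_inH.
Qed.

Lemma inHZ (k : R) f : inH f -> inH (fun x => k * f x).
Proof.
case/inHP=> mf ef hf; apply/inHP; split.
- exact: measurable_funM.
- by move=> x Ix; rewrite ef.
- by apply: eq_wint (wintZ (k ^+ 2) hf) => x _; rewrite exprMn.
Qed.

Lemma inHD f g : inH f -> inH g -> inH (fun x => f x + g x).
Proof.
case/inHP=> mf ef hf /inHP[mg eg hg]; apply/inHP; split.
- exact: measurable_funD.
- by move=> x Ix; rewrite ef ?eg.
- apply: (@wint_le _ (fun x => 2 * f x ^+ 2 + 2 * g x ^+ 2)).
  + by apply: measurable_funX; exact: measurable_funD.
  + by move=> x _; rewrite ger0_norm ?sqr_ge0//; have := sqr_ge0 (f x - g x); nra.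
  + by apply: wintD; exact: wintZ.
Qed.

Lemma inHB f g : inH f -> inH g -> inH (fun x => f x - g x).
Proof.
move=> Hf /(inHZ (-1)) Hg.
suff -> : (fun x => f x - g x) = (fun x => f x + -1 * g x) by exact: inHD.
by apply/funext => x; rewrite mulN1r.
Qed.

End WeightedIntegral.
#[global] Hint Extern 0 (measurable (@I11 _)) => exact: measurable_I11 : core.

(** * Orthogonality of the Chebyshev polynomials *)

Section Chebyshev.
Context {R : realType}.
Local Notation mu := (@lebesgue_measure R).
Local Notation I := (@I11 R).
Implicit Types (F G f phi : R -> R) (x t : R).

Lemma chebUSS n x : chebU n.+2 x = 2 * x * chebU n.+1 x - chebU n x.
Proof. by []. Qed.

Lemma chebU_ind (P : nat -> (R -> R) -> Prop) :
  P 0%N (chebU 0) -> P 1%N (chebU 1) ->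
  (forall n, P n (chebU n) -> P n.+1 (chebU n.+1) -> P n.+2 (chebU n.+2)) ->
  forall n, P n (chebU n).
Proof.
move=> P0 P1 PS n; suff : P n (chebU n) /\ P n.+1 (chebU n.+1) by case.
by elim: n => [|n [ih1 ih2]]; split => //; exact: PS.
Qed.

Lemma chebU_cos n t : chebU n (cos t) * sin t = sin (n.+1%:R * t).
Proof.
pose P n (f : R -> R) := f (cos t) * sin t = sin (n.+1%:R * t).
apply: (@chebU_ind P); rewrite /P.
- by rewrite /= !mul1r.
- rewrite /=; have -> : 2 * t = t + t by ring.
  by rewrite sinD; ring.
- move=> {}n h0 h1; rewrite chebUSS.
  rewrite (_ : _ * sin t = 2 * cos t * (chebU n.+1 (cos t) * sin t) - chebU n (cos t) * sin t);
    last by ring.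
  rewrite h1 h0.
  have -> : n.+3%:R * t = n.+2%:R * t + t by rewrite -[n.+3]addn1 natrD; ring.
  have -> : n.+1%:R * t = n.+2%:R * t - t by rewrite -[n.+2]addn1 natrD; ring.
  by rewrite sinB sinD; ring.
Qed.

Lemma chebUN n x : chebU n (- x) = (-1) ^+ n * chebU n x.
Proof.
pose P n (f : R -> R) := f (- x) = (-1) ^+ n * f x.
apply: (@chebU_ind P); rewrite /P.
- by rewrite /= mul1r.
- by rewrite /=; ring.
- by move=> {}n h0 h1; rewrite !chebUSS h0 h1 !exprS; ring.
Qed.

Lemma continuous_chebU n : continuous (@chebU R n).
Proof.
pose P (n : nat) (f : R -> R) := continuous f.
apply: (@chebU_ind P); rewrite /P.
- by move=> x; exact: cvg_cst.
- by move=> x; apply: cvgM; [exact: cvg_cst|exact: cvg_id].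
- move=> {}n h0 h1 x; apply: cvgB; last exact: h0.
  apply: cvgM; last exact: h1.
  by apply: cvgM; [exact: cvg_cst|exact: cvg_id].
Qed.

Lemma measurable_continuous F : continuous F -> measurable_fun I F.
Proof. by move=> cF; apply: measurable_funTS; exact: continuous_measurable_fun. Qed.

Lemma continuous_bounded_I11 F : continuous F ->
  exists B : R, forall x, I x -> `|F x| <= B.
Proof.
move=> cF; have cF' : {within `[(-1)%R, 1%R], continuous (fun x => `|F x|)}.
  apply: continuous_subspaceT => x.
  by apply: (@continuous_comp _ _ _ F Num.norm); [exact: cF|exact: norm_continuous].
have [|c cI cmax] := EVT_max _ cF'; first by lra.
by exists `|F c| => x /I11P h; apply: cmax; rewrite in_itv /=; lra.
Qed.

Lemma wint_continuous F : continuous F -> wint F.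
Proof.
move=> cF; have [B FB] := continuous_bounded_I11 cF.
by apply: wint_bounded FB; exact: measurable_continuous.
Qed.

(** Substitution [x = cos t]: one factor [sin t] is the weight and the other the Jacobian. *)
Lemma wip_cos F : continuous F ->
  wip F = \int[mu]_(t in `[0, pi]) (F (cos t) * sin t ^+ 2).
Proof.
move=> cF; rewrite /wip /Rintegral; congr fine.
have cFw : continuous (fun x => F x * wgt x).
  by move=> x; apply: cvgM; [exact: cF|exact: continuous_wgt].
(* The substitution rule applies on a closed interval, so the two null endpoints are added first. *)
rewrite /I11 integral_itv_bndo_bndc; last first.
  by apply/measurable_EFinP; apply: measurable_funTS; exact: continuous_measurable_fun.
rewrite integral_itv_obnd_cbnd; last first.
  by apply/measurable_EFinP; apply: measurable_funTS; exact: continuous_measurable_fun.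
have dcos : (@cos R)^`()%classic = (fun x => - sin x).
  by apply/funext => x; rewrite derive1E; apply: derive_val.
have := @integration_by_substitution_decreasing R cos (fun x => F x * wgt x) 0 pi (@pi_ge0 R).
rewrite cos0 cospi => -> //.
- apply: eq_integral => x; rewrite inE /= in_itv /= => x0pi.
  rewrite dcos; congr (_%:E); rewrite !fctE /= opprK /wgt.
  by rewrite -sin2cos2 sqrtr_sqr ger0_norm ?sin_ge0_pi// expr2 mulrA.
- by move=> x y xI yI xy; rewrite ltr_cos.
- move=> x _; rewrite dcos; apply: cvgN; exact: continuous_sin.
- rewrite dcos; apply/cvg_ex; exists (- sin 0).
  by apply: cvg_at_right_filter; apply: cvgN; exact: continuous_sin.
- rewrite dcos; apply/cvg_ex; exists (- sin pi).
  by apply: cvg_at_left_filter; apply: cvgN; exact: continuous_sin.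
- split.
  + by move=> x _; exact: derivable_cos.
  + by apply: cvg_at_right_filter; exact: continuous_cos.
  + by apply: cvg_at_left_filter; exact: continuous_cos.
- exact: continuous_subspaceT.
Qed.

Lemma continuous_cosM (k : R) : continuous (fun t : R => cos (k * t)).
Proof.
move=> t; apply: (@continuous_comp _ _ _ ( *%R k) cos); last exact: continuous_cos.
by apply: cvgM; [exact: cvg_cst|exact: cvg_id].
Qed.

Lemma integrable0pi F : continuous F -> mu.-integrable `[0, pi] (EFin \o F).
Proof.
move=> cF; apply: continuous_compact_integrable; first exact: segment_compact.
exact: continuous_subspaceT.
Qed.

Lemma integral_cosM n : \int[mu]_(t in `[0, pi]) cos (n.+1%:R * t) = 0 :> R.
Proof.
pose k : R := n.+1%:R.
have dF x : is_derive x 1 (fun t : R => k^-1 * sin (k * t)) (cos (k * x)).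
  have d1 : is_derive x 1 (fun t : R => k * t) k.
    have -> : (fun t : R => k * t) = k *: id by [].
    by apply: is_derive_eq; rewrite /GRing.scale /= mulr1.
  have d2 : is_derive x 1 (sin \o (fun t : R => k * t)) (cos (k * x) * k).
    exact: is_derive1_comp.
  have -> : (fun t : R => k^-1 * sin (k * t)) = k^-1 *: (sin \o (fun t : R => k * t)) by [].
  by apply: is_derive_eq; rewrite /GRing.scale /= mulrC mulfK// pnatr_eq0.
rewrite /Rintegral (@continuous_FTC2 R (fun t => cos (k * t))
  (fun t => k^-1 * sin (k * t)) 0 pi (@pi_gt0 R)).
- have sk : sin (k * pi) = 0.
    by rewrite mulr_natl -[_ *+ _]add0r (alternatingn (@sinDpi R)) sin0 mulr0.
  by rewrite sk !mulr0 sin0 mulr0 subee.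
- by apply: continuous_subspaceT; exact: continuous_cosM.
- have cF : continuous (fun t => k^-1 * sin (k * t)).
    move=> x; apply: cvgM; first exact: cvg_cst.
    apply: (@continuous_comp _ _ _ ( *%R k) sin); last exact: continuous_sin.
    by apply: cvgM; [exact: cvg_cst|exact: cvg_id].
  split.
  + by move=> x _; exact: (@ex_derive _ _ _ _ _ _ _ (dF x)).
  + by apply: cvg_at_right_filter; exact: cF.
  + by apply: cvg_at_left_filter; exact: cF.
- by move=> x _; rewrite derive1E; apply: (@derive_val _ _ _ _ _ _ _ (dF x)).
Qed.

Lemma integral_cosM_nat n :
  \int[mu]_(t in `[0, pi]) cos (n%:R * t) = pi * (n == 0%N)%:R :> R.
Proof.
case: n => [|n]; last by rewrite integral_cosM mulr0.
under eq_Rintegral do rewrite mul0r cos0.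
rewrite Rintegral_cst//= lebesgue_measure_itv /= lte_fin pi_gt0 mulr1 mul1r.
by rewrite oppr0 adde0.
Qed.

(** After [x = cos t] the integrand is [sin ((n+1)t) sin ((m+1)t)], half of
    [cos ((n-m)t) - cos ((n+m+2)t)]. The second frequency is never zero, so only [n = m]
    contributes. Ordering [m <= n] lets [n - m] be a natural number. *)
Lemma wip_chebU n m : wip (fun x => chebU n x * chebU m x) = (pi / 2) * (n == m)%:R.
Proof.
wlog mn : n m / (m <= n)%N.
  move=> h; case/orP: (leq_total m n) => [|nm]; first exact: h.
  rewrite eq_sym -h//; apply: eq_wip => x _; exact: mulrC.
rewrite wip_cos; last by move=> x; apply: cvgM; exact: continuous_chebU.
have nmE : (n - m)%:R = n%:R - m%:R :> R by rewrite natrB.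
transitivity (\int[mu]_(t in `[0, pi])
    (2^-1 * cos ((n - m)%:R * t) + (- 2^-1) * cos ((n + m).+2%:R * t))).
  apply: eq_Rintegral => t _.
  rewrite expr2 (_ : _ * _ = (chebU n (cos t) * sin t) * (chebU m (cos t) * sin t)); last by ring.
  rewrite !chebU_cos.
  have -> : (n - m)%:R * t = n.+1%:R * t - m.+1%:R * t.
    by rewrite nmE -[n.+1]addn1 -[m.+1]addn1 !natrD; ring.
  have -> : (n + m).+2%:R * t = n.+1%:R * t + m.+1%:R * t.
    by rewrite -[n.+1]addn1 -[m.+1]addn1 -[(n + m).+2]addn2 !natrD; ring.
  by rewrite cosB cosD; field.
have icos (k : R) : mu.-integrable `[0, pi] (EFin \o (fun t => cos (k * t))).
  by apply: integrable0pi; exact: continuous_cosM.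
have icosZ (c k : R) : mu.-integrable `[0, pi] (EFin \o (fun t => c * cos (k * t))).
  apply: integrable0pi => t; apply: cvgM; first exact: cvg_cst.
  exact: continuous_cosM.
rewrite RintegralD// !RintegralZl// integral_cosM mulr0 addr0 integral_cosM_nat.
by rewrite subn_eq0 eqn_leq mn andbT; ring.
Qed.

Lemma wip1 : wip (fun x => 1) = pi / 2 :> R.
Proof.
rewrite -[RHS]mulr1 -(wip_chebU 0 0).
by apply: eq_wip => x _ /=; rewrite mulr1.
Qed.

(** The image of Lebesgue measure under reflection gives half-open intervals their length, so
    uniqueness identifies it with Lebesgue measure. *)
Lemma lebesgue_measureN (A : set R) : measurable A -> mu (-%R @^-1` A) = mu A.
Proof.
have mN : measurable_fun [set: measurableTypeR R] (-%R : measurableTypeR R -> measurableTypeR R).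
  exact: oppr_measurable.
move=> mA; rewrite [RHS](@lebesgue_measure_unique R
  (@pushforward _ _ (measurableTypeR R) (measurableTypeR R) R mu -%R))//.
move=> _ [[a b] _ <-]; rewrite /pushforward.
rewrite [X in _ = lebesgue_measure X](_ : _ = `[- b, - a[%classic); last first.
  by apply/seteqP; split=> x /=; rewrite !in_itv /= => /andP[h1 h2]; apply/andP; split; lra.
rewrite !lebesgue_measure_itv /= !lte_fin ltrN2.
by case: ifPn => // _; rewrite -!EFinB; congr (_%:E); ring.
Qed.

Lemma wip_odd F : wint F -> (forall x, I x -> F (- x) = - F x) -> wip F = 0.
Proof.
move=> iF oF; pose g : R -> \bar R := EFin \o (fun x => F x * wgt x).
have mg : measurable_fun I g by case/integrableP : iF.
have mN : measurable_fun [set: measurableTypeR R] (-%R : measurableTypeR R -> measurableTypeR R).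
  exact: oppr_measurable.
have eqNI : -%R @^-1` I = I.
  by apply/seteqP; split=> x /I11P h; apply/I11P; lra.
(* Reflection exchanges the positive and negative parts of an odd integrand, so their integrals
   cancel. *)
have pE : (\int[mu]_(x in I) (g^\+)%E x = \int[mu]_(x in I) (g^\-)%E x)%E.
  rewrite -(@eq_measure_integral _ (measurableTypeR R) R I mu
    (@pushforward _ _ (measurableTypeR R) (measurableTypeR R) R mu -%R)); last first.
    by move=> A mA _; exact: lebesgue_measureN.
  rewrite ge0_integral_pushforward//; last exact: measurable_funepos.
  rewrite eqNI; apply: eq_integral => x; rewrite inE => Ix.
  by rewrite /= !unlock /g /= oF// wgtN mulNr EFinN.
rewrite /wip /Rintegral -/g integralE pE subee//.
apply: integrable_fin_num => //; exact: integrable_funeneg.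
Qed.

End Chebyshev.

(** * Pairings controlled by Chebyshev coefficients *)

Section Bessel.
Context {R : realType}.
Local Notation mu := (@lebesgue_measure R).
Local Notation I := (@I11 R).
Implicit Types (F G f phi : R -> R) (x t : R).

(* Bessel-type bound of [<f, phi>] by the coefficients of [f], in its AM-GM form:
   both sides pass to bounded pointwise limits in [phi]. *)
Definition bessel phi : Prop :=
  [/\ measurable_fun I phi, exists B, forall x, I x -> `|phi x| <= B &
    forall f e, inH f -> 0 < e ->
      (forall N, \sum_(n < N) cheb_coef f n ^+ 2 <= e ^+ 2) ->
      2 * wip (fun x => f x * phi x) <= e * (wip (fun x => phi x ^+ 2) + pi / 2)].

Lemma eq_bessel phi psi : phi =1 psi -> bessel phi -> bessel psi.
Proof. by move=> /funext ->. Qed.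

(** Dominated convergence on both sides, with dominants [B |f|] and [B^2]. This carries the estimate
    from polynomials to the kernel without any density statement in [H]. *)
Lemma bessel_lim (p : nat -> R -> R) phi (B : R) :
  (forall n, bessel (p n)) -> (forall n x, I x -> `|p n x| <= B) ->
  (forall x, I x -> p n x @[n --> \oo] --> phi x) -> bessel phi.
Proof.
move=> bp pB cp.
have mp n : measurable_fun I (p n) by case: (bp n).
have mphi : measurable_fun I phi by exact: measurable_fun_cvg cp.
have phiB x : I x -> `|phi x| <= B.
  move=> Ix; have cn := cvg_norm (cp x Ix).
  by apply: (@cvg_seq_le _ (fun n => `|p n x|)); [exact: cn|move=> n; exact: pB].
split => //; first by exists B.
move=> f e Hf e0 he.
have mf := inH_measurable Hf.
have c1 : 2 * wip (fun x => f x * p n x) @[n --> \oo] --> 2 * wip (fun x => f x * phi x).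
  apply: cvgM; first exact: cvg_cst.
  apply: (@wip_dct _ _ _ (fun x => B * `|f x|)).
  - by move=> n; apply: measurable_funM => //; exact: mp.
  - exact: measurable_funM.
  - by apply: wintZ; exact: wint_norm_inH.
  - by move=> x Ix; apply: cvgM; [exact: cvg_cst|exact: cp].
  - by move=> x n Ix; rewrite normrM mulrC ler_wpM2r// pB.
have c2 : e * (wip (fun x => p n x ^+ 2) + pi / 2) @[n --> \oo] -->
    e * (wip (fun x => phi x ^+ 2) + pi / 2).
  apply: cvgM; first exact: cvg_cst.
  apply: cvgD; last exact: cvg_cst.
  apply: (@wip_dct _ _ _ (cst (B ^+ 2))).
  - by move=> n; apply: measurable_funX; exact: mp.
  - exact: measurable_funX.
  - exact: wint_cst.
  - by move=> x Ix; apply: cvgM; exact: cp.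
  - by move=> x n Ix; rewrite normrX lerXn2r ?nnegrE ?pB// (le_trans _ (pB n x Ix)).
by apply: (ler_cvg_seq c1 c2) => n; case: (bp n) => _ _; apply.
Qed.

Lemma pihalf_gt0 : 0 < pi / 2 :> R.
Proof. by rewrite divr_gt0// pi_gt0. Qed.

Lemma pihalf_ge0 : 0 <= pi / 2 :> R.
Proof. exact: ltW pihalf_gt0. Qed.

Lemma pihalfK : pi / 2 * (2 / pi) = 1 :> R.
Proof. by rewrite -[2 / pi]invf_div divff// gt_eqF// pihalf_gt0. Qed.

Lemma wip_cheb_coef f n : wip (fun x => f x * chebU n x) = pi / 2 * cheb_coef f n.
Proof.
by rewrite /cheb_coef -/(wip (fun x => f x * chebU n x)) mulrA pihalfK mul1r.
Qed.

Lemma chebU_bounded n : exists B : R, forall x, I x -> `|chebU n x| <= B.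
Proof. by apply: continuous_bounded_I11; exact: continuous_chebU. Qed.

Lemma wint_inH_chebU f n : inH f -> wint (fun x => f x * chebU n x).
Proof.
move=> Hf; have [B hB] := chebU_bounded n; apply: wint_inHM hB => //.
by apply: measurable_continuous; exact: continuous_chebU.
Qed.

Definition chebsum (c : nat -> R) N x := \sum_(n < N) c n * chebU n x.

Lemma continuous_chebsum c N : continuous (chebsum c N).
Proof.
move=> x; rewrite /chebsum.
have -> : (fun x => \sum_(n < N) c n * chebU n x) = \sum_(n < N) (fun x => c n * chebU n x).
  by apply/funext => y; rewrite fct_sumE.
elim/big_ind: _.
- exact: cvg_cst.
- by move=> g h cg ch; exact: cvgD.
- by move=> i _; apply: cvgM; [exact: cvg_cst|exact: continuous_chebU].
Qed.

Lemma wip_inH_chebsum f c N : inH f ->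
  wip (fun x => f x * chebsum c N x) = pi / 2 * \sum_(n < N) c n * cheb_coef f n.
Proof.
move=> Hf.
transitivity (wip (fun x => \sum_(n < N) c n * (f x * chebU n x))).
  by apply: eq_wip => x _; rewrite mulr_sumr; apply: eq_bigr => i _; ring.
rewrite (@wip_sum _ N (fun n x => c n * (f x * chebU n x))); last first.
  by move=> i; apply: wintZ; exact: wint_inH_chebU.
rewrite mulr_sumr; apply: eq_bigr => i _.
by rewrite wipZ ?wip_cheb_coef; [ring|exact: wint_inH_chebU].
Qed.

Lemma wip_chebsumU c N m :
  wip (fun x => chebsum c N x * chebU m x) = pi / 2 * (if (m < N)%N then c m else 0).
Proof.
have iUU (n : nat) : wint (fun x : R => c n * (chebU n x * chebU m x)).
  apply: wint_continuous => x; apply: cvgM; first exact: cvg_cst.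
  by apply: cvgM; exact: continuous_chebU.
transitivity (wip (fun x => \sum_(n < N) c n * (chebU n x * chebU m x))).
  by apply: eq_wip => x _; rewrite mulr_suml; apply: eq_bigr => i _; ring.
rewrite (@wip_sum _ N (fun n x => c n * (chebU n x * chebU m x)))//.
transitivity (\sum_(i < N) if i == m :> nat then pi / 2 * c m else 0).
  apply: eq_bigr => i _; rewrite wipZ ?wip_chebU; last first.
    by apply: wint_continuous => x; apply: cvgM; exact: continuous_chebU.
  by case: eqP => [->|_]; rewrite /= ?mulr1n ?mulr0n ?mulr1 ?mulr0// mulrC.
rewrite -big_mkcond /=; case: ifPn => mN.
  by rewrite (big_pred1 (Ordinal mN)).
rewrite big_pred0 ?mulr0// => i; apply: contraNF mN => /eqP <-; exact: ltn_ord.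
Qed.

Lemma wip_chebsum_sqr c N :
  wip (fun x => chebsum c N x ^+ 2) = pi / 2 * \sum_(n < N) c n ^+ 2.
Proof.
have iU (n : nat) : wint (fun x : R => chebsum c N x * chebU n x).
  apply: wint_continuous => x; apply: cvgM; first exact: continuous_chebsum.
  exact: continuous_chebU.
transitivity (wip (fun x => \sum_(n < N) c n * (chebsum c N x * chebU n x))).
  apply: eq_wip => x _; rewrite expr2 {2}/chebsum mulr_sumr.
  by apply: eq_bigr => i _; ring.
rewrite (@wip_sum _ N (fun n x => c n * (chebsum c N x * chebU n x))); last first.
  by move=> n; apply: wintZ.
rewrite mulr_sumr; apply: eq_bigr => i _.
by rewrite wipZ// wip_chebsumU ltn_ord expr2; ring.
Qed.

(** Termwise [2 c a <= e c^2 + a^2 / e], and the hypothesis turns the sum of [a^2 / e] into at most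
    [e]. Multiplying by [pi / 2], the squared norm of each [U_n], produces the constant in
    [bessel]. *)
Lemma bessel_chebsum c N : bessel (chebsum c N).
Proof.
split.
- by apply: measurable_continuous; exact: continuous_chebsum.
- by apply: continuous_bounded_I11; exact: continuous_chebsum.
move=> f e Hf e0 he; rewrite wip_inH_chebsum// wip_chebsum_sqr.
have pi0 := @pi_gt0 R.
have key : 2 * \sum_(n < N) c n * cheb_coef f n <= e * \sum_(n < N) c n ^+ 2 + e.
  apply: (@le_trans _ _ (\sum_(n < N) (e * c n ^+ 2 + e^-1 * cheb_coef f n ^+ 2))).
    rewrite mulr_sumr; apply: ler_sum => i _.
    rewrite -subr_ge0 (_ : _ - _ = e^-1 * (e * c i - cheb_coef f i) ^+ 2).
      by rewrite mulr_ge0 ?invr_ge0 ?sqr_ge0// ltW.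
    by field; rewrite gt_eqF.
  rewrite big_split /= -!mulr_sumr lerD2l.
  by rewrite ler_pdivrMl// -expr2; exact: he.
have := ler_wpM2l pihalf_ge0 key; rewrite mulrDr => h.
apply: (le_trans _ (le_trans h _)); first by rewrite le_eqVlt; apply/orP; left; apply/eqP; ring.
by rewrite le_eqVlt; apply/orP; left; apply/eqP; ring.
Qed.

(** Asking for every length [M >= N] lets two expansions be compared at a common length, with no
    padding of coefficients. *)
Definition chebspan phi := exists c N, forall M x, (N <= M)%N -> phi x = chebsum c M x.

Lemma chebspanD phi psi : chebspan phi -> chebspan psi -> chebspan (fun x => phi x + psi x).
Proof.
move=> [c [N h]] [d [P k]]; exists (fun n => c n + d n), (maxn N P) => M x.
rewrite geq_max => /andP[NM PM]; rewrite (h M)// (k M)// /chebsum -big_split /=.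
by apply: eq_bigr => i _; rewrite mulrDl.
Qed.

Lemma chebspanZ (k : R) phi : chebspan phi -> chebspan (fun x => k * phi x).
Proof.
move=> [c [N h]]; exists (fun n => k * c n), N => M x NM.
by rewrite (h M)// /chebsum mulr_sumr; apply: eq_bigr => i _; rewrite mulrA.
Qed.

Lemma chebspanU n : chebspan (chebU n).
Proof.
exists (fun i => (i == n)%:R), n.+1 => M x nM.
rewrite /chebsum (bigD1 (Ordinal nM)) //= eqxx mul1r big1 ?addr0// => i.
by rewrite -val_eqE /= => /negbTE ->; rewrite mul0r.
Qed.

Lemma chebspan_sum N (p : nat -> R -> R) : (forall n, chebspan (p n)) ->
  chebspan (fun x => \sum_(n < N) p n x).
Proof.
move=> hp; elim: N => [|N ih].
  exists (fun=> 0), 0%N => M x _; rewrite big_ord0 /chebsum big1// => i _.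
  by rewrite mul0r.
have [c [K h]] := chebspanD ih (hp N); exists c, K => M x KM.
by rewrite -h// big_ord_recr.
Qed.

(* [2 x U_n = U_{n+1} + U_{n-1}] *)
Lemma chebspanX phi : chebspan phi -> chebspan (fun x => phi x * x).
Proof.
have UX n : chebspan (fun x => chebU n x * x).
  case: n => [|n].
    have [c [N h]] := chebspanZ 2^-1 (chebspanU 1); exists c, N => M x NM.
    by rewrite -h//=; field.
  have [c [N h]] := chebspanZ 2^-1 (chebspanD (chebspanU n.+2) (chebspanU n)).
  by exists c, N => M x NM; rewrite -h// chebUSS; field.
move=> [c [N h]].
have [d [P k]] := @chebspan_sum N (fun n x => c n * (chebU n x * x))
  (fun n => chebspanZ (c n) (UX n)).
exists d, P => M x PM; rewrite -k// (h N)// /chebsum mulr_suml.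
by apply: eq_bigr => i _; ring.
Qed.

Lemma chebspan_poly (p : {poly R}) : chebspan (horner p).
Proof.
elim/poly_ind: p => [|p k [c [N h]]].
  exists (fun=> 0), 0%N => M x _; rewrite horner0 /chebsum big1// => i _.
  by rewrite mul0r.
have pX : chebspan (fun x => p.[x] * x) by apply: chebspanX; exists c, N.
have [d [P g]] := chebspanD pX (chebspanZ k (chebspanU 0)).
by exists d, P => M x PM; rewrite -g// hornerMXaddC /= mulr1.
Qed.

Lemma bessel_poly (p : {poly R}) : bessel (horner p).
Proof.
have [c [N h]] := chebspan_poly p.
by apply: eq_bessel (bessel_chebsum c N) => x; rewrite (h N).
Qed.

End Bessel.

(** * The kernel of the bending moment *)

Section Kernel.
Context {R : realType}.
Local Notation mu := (@lebesgue_measure R).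
Local Notation I := (@I11 R).
Implicit Types (F G f phi : R -> R) (x y t xi b : R).

(* Iteration [p := p + (y^2 - p^2) / 2], increasing to [|y|] on [-1, 1]. *)
Fixpoint abs_poly (n : nat) : {poly R} :=
  if n is n'.+1 then abs_poly n' + 2^-1 *: ('X ^+ 2 - abs_poly n' ^+ 2) else 0.

(** With [a = |y|] and [p] the current value, one step multiplies the error [a - p] by
    [1 - (a + p) / 2]. Since [0 <= p <= a <= 1], this factor lies between [0] and [1 - a / 2]. *)
Lemma abs_polyP n y : `|y| <= 1 ->
  0 <= (abs_poly n).[y] /\ 0 <= `|y| - (abs_poly n).[y] <= (1 - `|y| / 2) ^+ n.
Proof.
move=> y1; have y0 := normr_ge0 y.
elim: n => [|n [p0 /andP[py yp]]] /=.
  by rewrite horner0 subr0 expr0 y0 y1.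
rewrite !(hornerE, horner_exp) -[y ^+ 2]real_normK ?num_real//.
set p := (abs_poly n).[y] in p0 py yp *; set a := `|y| in y1 y0 py yp *.
have -> : a - (p + 2^-1 * (a ^+ 2 - p ^+ 2)) = (a - p) * (1 - (a + p) / 2) by field.
split; first by nra.
have pa : p <= a by lra.
apply/andP; split; first by apply: mulr_ge0; lra.
by rewrite exprSr; apply: ler_pM => //; lra.
Qed.

Lemma cvg_abs_poly y : `|y| <= 1 -> (abs_poly n).[y] @[n --> \oo] --> `|y|.
Proof.
(* At [y = 0] the geometric ratio degenerates to [1]; there the two bounds already force every
   iterate to vanish. *)
move=> y1; have [->|y0] := eqVneq y 0.
  rewrite normr0 (_ : (fun n => _) = cst 0); first exact: cvg_cst.
  apply/funext => n; have := abs_polyP n (y := 0).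
  by rewrite normr0 => /(_ ler01) [h1 /andP[h2 h3]] /=; lra.
have y0' : 0 < `|y| by rewrite normr_gt0.
apply: (@squeeze_cvgr _ _ _ _ (fun n => `|y| - (1 - `|y| / 2) ^+ n) (fun n => `|y|)).
- by apply: nearW => n; have [h1 /andP[h2 h3]] := abs_polyP n y1; lra.
- rewrite -[X in _ --> X]subr0; apply: cvgB; first exact: cvg_cst.
  by apply: cvg_expr; rewrite ger0_norm; lra.
- exact: cvg_cst.
Qed.

Lemma horner_bounded (p : {poly R}) : exists B : R, forall x, I x -> `|p.[x]| <= B.
Proof. by apply: continuous_bounded_I11; exact: continuous_horner. Qed.

(** On [I] one has [|x - xi| < 2], while [abs_poly] converges on [[-1, 1]]; hence the rescaling
    [|x - xi| = 2 |(x - xi) / 2|], which is also the source of the [2] in the bound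
    [MA + 2 * MB]. *)
Lemma bessel_abs (A B : {poly R}) xi : 0 <= xi <= 1 ->
  bessel (fun x => A.[x] + B.[x] * `|x - xi|).
Proof.
move=> xi01.
have [MA hA] := horner_bounded A; have [MB hB] := horner_bounded B.
pose q n : {poly R} := A + (2 *: B) * (abs_poly n \Po (2^-1 *: ('X - xi%:P))).
have qE n x : (q n).[x] = A.[x] + 2 * B.[x] * (abs_poly n).[(x - xi) / 2].
  by rewrite /q !(hornerE, horner_comp) [2^-1 * _]mulrC.
have small x : I x -> `|(x - xi) / 2| <= 1.
  by move=> /I11P h; rewrite ler_norml; lra.
apply: (@bessel_lim _ (fun n => horner (q n)) _ (MA + 2 * MB)).
- by move=> n; exact: bessel_poly.
- move=> n x Ix; rewrite qE.
  have [p0 /andP[p1 p2]] := abs_polyP n (small x Ix).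
  apply: (le_trans (ler_normD _ _)); apply: lerD; first exact: hA.
  rewrite !normrM ger0_norm// (ger0_norm p0) -[leRHS]mulr1.
  apply: ler_pM => //.
    by rewrite ler_wpM2l// hB.
  by have := small x Ix; lra.
- move=> x Ix.
  have -> : A.[x] + B.[x] * `|x - xi| = A.[x] + 2 * B.[x] * `|(x - xi) / 2|.
    by rewrite normrM (@ger0_norm _ 2^-1)//; field.
  under eq_fun do rewrite qE.
  apply: cvgD; first exact: cvg_cst.
  by apply: cvgM; [exact: cvg_cst|apply: cvg_abs_poly; exact: small].
Qed.

(** The algebra generated by the polynomials and [|x - xi|]. Two polynomial coefficients are enough
    because [|x - xi|^2] is itself a polynomial. *)
Definition absspan xi phi :=
  exists A B : {poly R}, forall x, phi x = A.[x] + B.[x] * `|x - xi|.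

Lemma absspanM xi phi psi : absspan xi phi -> absspan xi psi ->
  absspan xi (fun x => phi x * psi x).
Proof.
move=> [A [B h]] [C [D k]].
exists (A * C + B * D * ('X - xi%:P) ^+ 2), (A * D + B * C) => x.
have sq : `|x - xi| ^+ 2 = (x - xi) ^+ 2 by rewrite real_normK// num_real.
transitivity (A.[x] * C.[x] + B.[x] * D.[x] * `|x - xi| ^+ 2 +
    (A.[x] * D.[x] + B.[x] * C.[x]) * `|x - xi|).
  by rewrite h k; ring.
by rewrite sq !(hornerE, horner_exp).
Qed.

Lemma absspanD xi phi psi : absspan xi phi -> absspan xi psi ->
  absspan xi (fun x => phi x + psi x).
Proof.
move=> [A [B h]] [C [D k]]; exists (A + C), (B + D) => x.
by rewrite h k !hornerD; ring.
Qed.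

Lemma absspan_cst xi (k : R) : absspan xi (cst k).
Proof. by exists k%:P, 0 => x; rewrite hornerC horner0 mul0r addr0. Qed.

Definition pospart y := Num.max y 0.

Lemma pospartE y : pospart y = (y + `|y|) / 2.
Proof.
rewrite /pospart; have [y0|y0] := leP y 0.
  by rewrite ler0_norm// subrr mul0r.
by rewrite gtr0_norm//; field.
Qed.

Lemma pospart_ge0 y : 0 <= pospart y.
Proof. by rewrite /pospart le_max lexx orbT. Qed.

Lemma continuous_pospart : continuous pospart.
Proof.
have -> : pospart = (fun y => (y + `|y|) / 2) by apply/funext => y; exact: pospartE.
move=> y; apply: cvgM; last exact: cvg_cst.
by apply: cvgD; [exact: cvg_id|exact: norm_continuous].
Qed.

Lemma absspan_pospart xi : absspan xi (fun x => pospart (x - xi)).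
Proof.
exists (2^-1 *: ('X - xi%:P)), (2^-1)%:P => x.
by rewrite pospartE !hornerE; field.
Qed.

Lemma absspanX xi phi n : absspan xi phi -> absspan xi (fun x => phi x ^+ n).
Proof.
move=> h; elim: n => [|n ih].
  have [A [B k]] := absspan_cst xi 1; exists A, B => x; rewrite expr0.
  exact: k.
have [A [B k]] := absspanM h ih; exists A, B => x; rewrite exprS.
exact: k.
Qed.

(** Placing the cutoff inside the sine makes the kernel vanish for [x <= xi] and stay continuous, so
    the integral over [[xi, 1]] becomes a pairing over all of [I]. *)
Definition kern b xi x := sin (b * pospart (x - xi) / 2).

Lemma continuous_kern b xi : continuous (kern b xi).
Proof.
move=> x; apply: (@continuous_comp _ _ _ (fun x => b * pospart (x - xi) / 2) sin).
  apply: cvgM; last exact: cvg_cst.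
  apply: cvgM; first exact: cvg_cst.
  apply: (@continuous_comp _ _ _ (fun x => x - xi) pospart).
    by apply: cvgB; [exact: cvg_id|exact: cvg_cst].
  exact: continuous_pospart.
exact: continuous_sin.
Qed.

Lemma kern_le1 b xi x : `|kern b xi x| <= 1.
Proof. exact: sin_max. Qed.

Lemma series_sin_coeff_le y n : `|series (sin_coeff y) n| <= expR `|y|.
Proof.
have nd : nondecreasing_seq (series (exp_coeff `|y|)).
  apply/nondecreasing_seqP => m; rewrite /series /= big_nat_recr//= lerDl.
  exact: exp_coeff_ge0.
apply: le_trans (nondecreasing_cvgn_le nd (is_cvg_series_exp_coeff _) n).
apply: (le_trans (ler_norm_sum _ _ _)); apply: ler_sum => i _.
rewrite /exp_coeff /sin_coeff /= !normrM normfV !normr_nat !normrX normrN normr1 expr1n mulr1.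
by case: odd; rewrite ?mul1r// !mul0r divr_ge0.
Qed.

(** Each partial sum of the sine series, evaluated at [b (x - xi)_+ / 2], lies in [absspan xi], so
    [bessel_abs] applies to it. The bound [expR |b|], independent of the length, then allows a
    second application of [bessel_lim]. *)
Lemma bessel_kern b xi : 0 <= xi <= 1 -> bessel (kern b xi).
Proof.
move=> xi01.
pose p (n : nat) x := series (sin_coeff (b * pospart (x - xi) / 2)) n.
have small x : I x -> `|b * pospart (x - xi) / 2| <= `|b|.
  move=> /I11P h; have p0 := pospart_ge0 (x - xi).
  have p1 : pospart (x - xi) <= 1 by rewrite /pospart ge_max; lra.
  by rewrite -mulrA normrM ler_piMr// ger0_norm; lra.
apply: (@bessel_lim _ p _ (expR `|b|)).
- move=> n.
  suff [A [B h]] : absspan xi (p n).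
    by apply: eq_bessel (bessel_abs A B xi01) => x; rewrite h.
  have term i : absspan xi (fun x => sin_coeff (b * pospart (x - xi) / 2) i).
    have [A [B k]] := absspanM (absspan_cst xi ((odd i)%:R * (-1) ^+ i.-1./2 / i`!%:R))
      (absspanX i (absspanM (absspan_cst xi (b / 2)) (absspan_pospart xi))).
    exists A, B => x; rewrite -k /sin_coeff /=.
    by rewrite (mulrAC b); ring.
  elim: n => [|n ih].
    have [A [B k]] := absspan_cst xi 0; exists A, B => x; rewrite -k /p /series /=.
    by rewrite big_geq.
  have [A [B k]] := absspanD ih (term n); exists A, B => x; rewrite -k.
  by rewrite /p /series /= big_nat_recr.
- move=> n x Ix; apply: (le_trans (series_sin_coeff_le _ _)).
  by rewrite ler_expR small.
- move=> x Ix; rewrite /kern unlock; exact: is_cvg_series_sin_coeff.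
Qed.

End Kernel.

(** * A Riesz-Fischer theorem *)

Section RieszFischer.
Context {R : realType}.
Local Notation mu := (@lebesgue_measure R).
Local Notation I := (@I11 R).
Implicit Types (F G f phi : R -> R) (x y t xi b : R).

Lemma integral_wip F : wint F -> (\int[mu]_(x in I) (F x * wgt x)%:E = (wip F)%:E)%E.
Proof. by move=> iF; rewrite /wip /Rintegral fineK// integrable_fin_num. Qed.

Variables (c : nat -> R) (C : R).
Hypothesis c_odd : forall n, odd n -> c n = 0.
Hypothesis c_sum : forall N, \sum_(n < N) n.+1%:R * c n ^+ 2 <= C.

(** Only the lengths [4 ^ k] are used: thanks to the weight [n.+1] in [c_sum], successive blocks
    have weighted [L^1] norms of order [2^-k], so the sums converge absolutely almost everywhere
    along the sequence itself. *)
Let S k x := chebsum c (4 ^ k)%N x.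

Let C_ge0 : 0 <= C.
Proof. by apply: le_trans (c_sum 0); rewrite big_ord0. Qed.

Let S_even k x : S k (- x) = S k x.
Proof.
apply: eq_bigr => i _; rewrite chebUN.
have [oi|ei] := boolP (odd i); first by rewrite c_odd// !mul0r.
by rewrite -signr_odd (negbTE ei) mul1r.
Qed.

Let continuous_S k : continuous (S k).
Proof. exact: continuous_chebsum. Qed.

Let wip_S_sqr k : wip (fun x => S k x ^+ 2) <= pi / 2 * C.
Proof.
rewrite wip_chebsum_sqr ler_wpM2l ?pihalf_ge0//.
apply: le_trans (c_sum (4 ^ k)%N); apply: ler_sum => i _.
by rewrite ler_peMl ?sqr_ge0// ler1n.
Qed.

(** Every index in the block is at least [4 ^ k], so the weighted bound [C] can be divided by
    [4 ^ k]. *)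
Let wip_SB_sqr k : wip (fun x => (S k.+1 x - S k x) ^+ 2) <= pi / 2 * C / 4 ^+ k.
Proof.
have kk : (4 ^ k <= 4 ^ k.+1)%N by rewrite leq_exp2l.
pose d n := if (n < 4 ^ k)%N then 0 else c n.
have dE x : S k.+1 x - S k x = chebsum d (4 ^ k.+1)%N x.
  rewrite /S /chebsum (big_ord_widen_cond _ xpredT (fun n => c n * chebU n x) kk).
  rewrite [X in _ - X]big_mkcond -sumrB; apply: eq_bigr => i _ /=; rewrite /d.
  by case: ifP => _; rewrite ?mul0r ?subrr// subr0.
rewrite (eq_wip (G := fun x => chebsum d (4 ^ k.+1)%N x ^+ 2)); last by move=> x _; rewrite dE.
rewrite wip_chebsum_sqr -[leRHS]mulrA ler_wpM2l ?pihalf_ge0//.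
rewrite ler_pdivlMr ?exprn_gt0// mulr_suml.
apply: le_trans (c_sum (4 ^ k.+1)%N); apply: ler_sum => i _; rewrite /d.
case: ltnP => ki; first by rewrite expr0n mul0r mulr_ge0 ?sqr_ge0.
by rewrite mulrC ler_wpM2r ?sqr_ge0// -natrX ler_nat (leq_trans ki).
Qed.

Let u k x : R := `|S k.+1 x - S k x|.

Let continuous_u k : continuous (u k).
Proof.
move=> x; apply: (@continuous_comp _ _ _ (fun x => S k.+1 x - S k x) Num.norm).
  by apply: cvgB; exact: continuous_S.
exact: norm_continuous.
Qed.

Let K := pi / 2 * (C + 1) / 2.

(** Cauchy-Schwarz is replaced by [|v| <= 2^k v^2 / 2 + 1 / (2 * 2^k)]. Integrating, the two terms
    give [(pi/2) C / 2] and [(pi/2) / 2], each over [2^k], which add up to [K / 2^k]. *)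
Let wip_u k : wip (u k) <= K / 2 ^+ k.
Proof.
have p2 : 0 < 2 ^+ k :> R by rewrite exprn_gt0.
have i2 : wint (fun x => (S k.+1 x - S k x) ^+ 2).
  apply: wint_continuous => x.
  apply: (@continuous_comp _ _ _ (fun x => S k.+1 x - S k x) (fun y => y ^+ 2)).
    by apply: cvgB; exact: continuous_S.
  exact: exprn_continuous.
apply: (@le_trans _ _ (wip (fun x => 2 ^+ k / 2 * (S k.+1 x - S k x) ^+ 2 + (2 ^+ k * 2)^-1 * 1))).
  apply: le_wip; first exact: wint_continuous.
    by apply: wintD; apply: wintZ => //; exact: wint_cst.
  move=> x _; rewrite /u -(@real_normK _ (S k.+1 x - S k x)) ?num_real//.
  rewrite -subr_ge0 (_ : _ - _ = (2 ^+ k * 2)^-1 * (2 ^+ k * `|S k.+1 x - S k x| - 1) ^+ 2).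
    by rewrite mulr_ge0 ?sqr_ge0// invr_ge0 mulr_ge0// ltW.
  by field; rewrite gt_eqF.
rewrite wipD; [|by apply: wintZ|by apply: wintZ; exact: wint_cst].
rewrite !wipZ ?wip1//; last exact: wint_cst.
have h : 2 ^+ k / 2 * wip (fun x => (S k.+1 x - S k x) ^+ 2) <= 2 ^+ k / 2 * (pi / 2 * C / 4 ^+ k).
  by rewrite ler_wpM2l// divr_ge0// ltW.
apply: (le_trans (lerD h (lexx _))); rewrite le_eqVlt; apply/orP; left; apply/eqP.
have -> : 4 ^+ k = 2 ^+ k * 2 ^+ k :> R by rewrite -exprMn; congr (_ ^+ _); ring.
rewrite /K; set p := pi / 2; field.
by rewrite gt_eqF.
Qed.

Let G x : \bar R := (\sum_(k <oo) (u k x * wgt x)%:E)%E.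

Let uw_ge0 k x : (0 <= (u k x * wgt x)%:E)%E.
Proof. by rewrite lee_fin mulr_ge0 ?wgt_ge0 ?normr_ge0. Qed.

Let measurable_uw k : measurable_fun setT (fun x => (u k x * wgt x)%:E).
Proof.
apply/measurable_EFinP; apply: continuous_measurable_fun => x.
by apply: cvgM; [exact: continuous_u|exact: continuous_wgt].
Qed.

Let measurable_G : measurable_fun setT G.
Proof. by apply: ge0_emeasurable_sum => // k x _ _; exact: uw_ge0. Qed.

Let integral_G : (\int[mu]_(x in I) G x <= (2 * K)%:E)%E.
Proof.
rewrite integral_nneseries//; last first.
  by move=> n; apply: measurable_funTS; exact: measurable_uw.
(* The subtracted term is the remaining geometric tail; it is what makes the induction close. *)
have pK n : (\sum_(k < n) wip (u k) <= 2 * K - 2 * K / 2 ^+ n).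
  elim: n => [|n ih]; first by rewrite big_ord0 expr0 divr1 subrr.
  rewrite big_ord_recr /=; apply: (le_trans (lerD ih (wip_u n))).
  have p2 : 0 < 2 ^+ n :> R by rewrite exprn_gt0.
  rewrite exprS le_eqVlt; apply/orP; left; apply/eqP; field.
  by rewrite gt_eqF.
have K0 : 0 <= K.
  by rewrite /K divr_ge0// mulr_ge0 ?pihalf_ge0// addr_ge0.
apply: lime_le.
  by apply: is_cvg_nneseries => n _ _; apply: integral_ge0 => x _; exact: uw_ge0.
apply: nearW => n; rewrite big_mkord.
under eq_bigr => i _ do rewrite (integral_wip (wint_continuous (@continuous_u i))).
rewrite sumEFin lee_fin; apply: (le_trans (pK n)).
by rewrite gerBl; apply: divr_ge0; [exact: mulr_ge0|exact: exprn_ge0].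
Qed.

Let G_ge0 x : (0 <= G x)%E.
Proof. by apply: nneseries_ge0 => k _ _; exact: uw_ge0. Qed.

Let integrable_G : mu.-integrable I G.
Proof.
apply/integrableP; split; first by apply: measurable_funTS.
under eq_integral do rewrite gee0_abs//.
by apply: (le_lt_trans integral_G); rewrite ltry.
Qed.

Let good x := (G x < +oo)%E.

Let ae_good : {ae mu, forall x, I x -> good x}.
Proof.
have := integrable_ae (mu := mu) measurable_I11 integrable_G.
by apply: ae_impl => x h Ix; rewrite /good ltey_eq h.
Qed.

(** A common bound for all [S n] at good points. [G] already contains the weight, hence the
    division; against the weight [D] is integrable. *)
Let D x := `|S 0 x| + fine (G x) / wgt x.

Let partial_u x n : I x -> good x -> \sum_(k < n) u k x <= fine (G x) / wgt x.
Proof.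
move=> Ix gx; rewrite ler_pdivlMr ?wgt_gt0// mulr_suml -lee_fin fineK.
  rewrite -sumEFin -(big_mkord xpredT (fun k => (u k x * wgt x)%:E)).
  by apply: nneseries_lim_ge => k _ _; exact: uw_ge0.
by rewrite ge0_fin_numE.
Qed.

Let S_telescope x n : S n x = S 0 x + \sum_(k < n) (S k.+1 x - S k x).
Proof. by rewrite -(big_mkord xpredT (fun k => S k.+1 x - S k x)) telescope_sumr// addrC subrK. Qed.

Let S_le x n : I x -> good x -> `|S n x| <= D x.
Proof.
move=> Ix gx; rewrite S_telescope; apply: (le_trans (ler_normD _ _)).
rewrite lerD2l; apply: (le_trans (ler_norm_sum _ _ _)); exact: partial_u.
Qed.

Let cvg_S x : I x -> good x -> cvgn (S ^~ x).
Proof.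
move=> Ix gx.
have : cvgn (series (fun k => S k.+1 x - S k x)).
  apply: normed_cvg.
  have -> : [normed series (fun k => S k.+1 x - S k x)] = (fun n => \sum_(k < n) u k x).
    by apply/funext => n; rewrite /= seriesEord.
  apply: nondecreasing_is_cvgn.
    by apply/nondecreasing_seqP => m; rewrite big_ord_recr /= lerDl normr_ge0.
  by exists (fine (G x) / wgt x) => _ [n _ <-]; exact: partial_u.
move=> h; have -> : S ^~ x = (fun n => S 0 x + series (fun k => S k.+1 x - S k x) n).
  by apply/funext => n; rewrite S_telescope /series /= big_mkord.
by apply: is_cvgD => //; exact: is_cvg_cst.
Qed.

(** Setting the sums to zero off the good set makes them converge at every point of [I], so the
    limit is measurable as an everywhere limit. *)
Let T k x := S k x * \1_[set x | good x] x.

Let f x := limn (T ^~ x).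

Let T_good k x : good x -> T k x = S k x.
Proof. by move=> gx; rewrite /T indicE mem_set// mulr1. Qed.

Let T_bad k x : ~ good x -> T k x = 0.
Proof. by move=> gx; rewrite /T indicE memNset// mulr0. Qed.

Let cvg_T x : I x -> T k x @[k --> \oo] --> f x.
Proof.
move=> Ix; rewrite /f; have [gx|gx] := pselect (good x).
  have -> : T ^~ x = S ^~ x by apply/funext => k; exact: T_good.
  exact: cvg_S.
have -> : T ^~ x = cst 0 by apply/funext => k; exact: T_bad.
exact: is_cvg_cst.
Qed.

Let measurable_T k : measurable_fun I (T k).
Proof.
apply: measurable_funM; first exact: measurable_continuous.
apply: measurable_funTS; apply: measurable_indic.
by rewrite -[X in measurable X]setTI; exact: emeasurable_fun_infty_o.
Qed.

Let measurable_f : measurable_fun I f.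
Proof. by apply: (measurable_fun_cvg measurable_T) => x Ix; exact: cvg_T. Qed.

(** [inH] asks for evenness at every point, so the exceptional set must be symmetric too. It is,
    because [G] inherits evenness from the sums [S k]. *)
Let f_even x : f (- x) = f x.
Proof.
have uN k y : u k (- y) = u k y by rewrite /u !S_even.
have GN : G (- x) = G x by apply: eq_eseriesr => k _; rewrite uN wgtN.
have TN : T ^~ (- x) = T ^~ x; last by rewrite /f TN.
apply/funext => k; rewrite /T S_even; congr (_ * _).
by rewrite !indicE; congr ((_ : bool)%:R); apply/idP/idP; rewrite !inE /good /= GN.
Qed.

Let sqrw_ge0 y x : 0 <= y ^+ 2 * wgt x.
Proof. by apply: mulr_ge0; [exact: sqr_ge0|exact: wgt_ge0]. Qed.

(** Fatou along [T k], whose squares are dominated by those of [S k], with integrals at most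
    [pi / 2 * C]. *)
Let wint_f_sqr : wint (fun x => f x ^+ 2).
Proof.
have mTw k : measurable_fun I (fun x => (T k x ^+ 2 * wgt x)%:E).
  apply/measurable_EFinP; apply: measurable_funM; last exact: measurable_wgt.
  by apply: measurable_funX; exact: measurable_T.
apply/integrableP; split.
  apply/measurable_EFinP; apply: measurable_funM; last exact: measurable_wgt.
  exact: measurable_funX.
apply: (@le_lt_trans _ _ (pi / 2 * C)%:E); last exact: ltry.
have -> : (\int[mu]_(x in I) `|(EFin \o (fun x => (f x ^+ 2 * wgt x)%R)) x| =
    \int[mu]_(x in I) limn_einf (fun k => (T k x ^+ 2 * wgt x)%:E))%E.
  apply: eq_integral => x; rewrite inE => Ix.
  rewrite /= ger0_norm ?sqrw_ge0//.
  have /cvg_limn_einf_sup[-> _//] : (T k x ^+ 2 * wgt x)%:E @[k --> \oo] --> (f x ^+ 2 * wgt x)%:E.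
  apply: cvg_EFin; first exact: nearW.
  by apply: cvgM; [apply: cvgM; exact: cvg_T|exact: cvg_cst].
have T0 k x : I x -> (0 <= (T k x ^+ 2 * wgt x)%:E)%E.
  by move=> _; rewrite lee_fin sqrw_ge0.
apply: (le_trans (fatou mu measurable_I11 mTw T0)).
have bT k : (\int[mu]_(x in I) (T k x ^+ 2 * wgt x)%:E <= (pi / 2 * C)%:E)%E.
  have iS : wint (fun x => S k x ^+ 2).
    by apply: wint_continuous => x; apply: cvgM; exact: continuous_S.
  apply: (@le_trans _ _ (wip (fun x => S k x ^+ 2))%:E); last by rewrite lee_fin.
  rewrite -integral_wip//; apply: ge0_le_integral => //.
  - by move=> x _; rewrite lee_fin sqrw_ge0.
  - exact: mTw.
  - by case/integrableP : iS.
  - move=> x _; rewrite lee_fin ler_wpM2r ?wgt_ge0//.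
    have [gx|gx] := pselect (good x); first by rewrite T_good.
    by rewrite T_bad// expr0n sqr_ge0.
rewrite limn_einf_lim; apply: lime_le; first exact: is_cvg_einfs.
apply: nearW => n; apply: le_trans (bT n); apply: ereal_inf_lbound.
by exists n => /=.
Qed.

(** As [U_n] is bounded, the [L^1] dominant [B * D] suffices to pass the coefficients to the limit;
    no [L^2] convergence of the sums is needed. *)
Lemma riesz_fischer : exists g, inH g /\ forall n, cheb_coef g n = c n.
Proof.
exists f; split; first by apply/inHP; split.
move=> n; have [B hB] := @chebU_bounded R n.
have B0 : 0 <= B by apply: le_trans (hB 0 _); rewrite ?I11P//; lra.
have mU : measurable_fun I (@chebU R n).
  by apply: measurable_continuous; exact: continuous_chebU.
have iD : wint (fun x => B * D x).
  apply: wintZ; apply: wintD.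
    by apply: wint_norm; exact: wint_continuous.
  have ifG : mu.-integrable I (EFin \o (fun x => fine (G x))).
    apply: le_integrable integrable_G => //.
      apply/measurable_EFinP; apply: measurableT_comp => //; exact: measurable_funTS.
    move=> x Ix /=.
    by case: (G x) (G_ge0 x) => [r| |]//= _; rewrite normr0 leey.
  rewrite /wint; apply: eq_integrable ifG => // x /[!inE] Ix.
  by rewrite /= mulfVK ?gt_eqF ?wgt_gt0.
have h : wip (fun x => S k x * chebU n x) @[k --> \oo] --> wip (fun x => f x * chebU n x).
  apply: (@wip_dct_ae _ _ _ (fun x => B * D x)) => //.
  - by move=> k; apply: measurable_funM => //; exact: measurable_continuous.
  - exact: measurable_funM.
  - apply: ae_impl ae_good => x gx Ix; apply: cvgM; last exact: cvg_cst.
    have := cvg_T Ix; have -> // : T ^~ x = S ^~ x.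
    by apply/funext => k; apply: T_good; exact: gx.
  - apply: ae_impl ae_good => x gx k Ix; rewrite normrM mulrC.
    by apply: ler_pM => //; [exact: hB|apply: S_le => //; exact: gx].
have e : wip (fun x => S k x * chebU n x) @[k --> \oo] --> pi / 2 * c n.
  (* The coefficient is exactly [c n] as soon as [n <= k], because [k < 4 ^ k]. *)
  apply: cvg_near_cst; exists n => // k /= nk; rewrite wip_chebsumU ifT//.
  by apply: (leq_ltn_trans nk); rewrite ltn_expl.
have := cvg_unique (@Rhausdorff R) h e.
have p0 : pi / 2 != 0 :> R by rewrite gt_eqF// pihalf_gt0.
by rewrite wip_cheb_coef => /(_ _)/(mulfI p0); apply.
Qed.

End RieszFischer.

(** * Bending moments *)

Section Moment.
Context {R : realType}.
Local Notation mu := (@lebesgue_measure R).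
Local Notation I := (@I11 R).
Implicit Types (F G f g phi : R -> R) (x y t xi b : R).

Definition moment b f xi := b / 2 * wip (fun x => f x * kern b xi x).

Lemma bmomentE b f xi : 0 <= xi -> bmoment b f xi = moment b f xi.
Proof.
move=> xi0; rewrite /bmoment /moment /wip; congr (_ * _).
rewrite Rintegral_mkcond [RHS]Rintegral_mkcond; congr (Rintegral _ _ _).
apply/funext => x; rewrite /patch !mem_setE !in_itv /=.
rewrite /kern /pospart; have [xxi|xxi] /= := lerP xi x; last first.
  by rewrite max_r ?mulr0 ?mul0r ?sin0 ?mulr0 ?mul0r ?if_same// subr_le0 ltW.
rewrite max_l ?subr_ge0//.
have -> /= : -1 < x by lra.
(* The endpoint [1] lies in [[xi, 1]] but not in [I]; the weight vanishes there, so the integrands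
   still agree. *)
have [x1|x1|->] := ltgtP x 1; [by ring|by []|by rewrite /= !(wgt1, mulr0, mul0r)].
Qed.

Lemma measurable_kern b xi : measurable_fun I (kern b xi).
Proof. by apply: measurable_continuous; exact: continuous_kern. Qed.

Lemma wint_kern b xi f : inH f -> wint (fun x => f x * kern b xi x).
Proof.
move=> Hf; apply: (@wint_inHM _ _ _ 1) => //; first exact: measurable_kern.
by move=> x _; exact: kern_le1.
Qed.

Lemma cheb_coefE f n : cheb_coef f n = 2 / pi * wip (fun x => f x * chebU n x).
Proof. by []. Qed.

Lemma cheb_coefZ (k : R) f n : inH f -> cheb_coef (fun x => k * f x) n = k * cheb_coef f n.
Proof.
move=> Hf; rewrite !cheb_coefE [RHS]mulrCA -(wipZ k); last exact: wint_inH_chebU.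
by congr (_ * _); apply: eq_wip => x _; rewrite mulrA.
Qed.

Lemma cheb_coefB f g n : inH f -> inH g ->
  cheb_coef (fun x => f x - g x) n = cheb_coef f n - cheb_coef g n.
Proof.
move=> Hf Hg; rewrite !cheb_coefE -mulrBr -wipB; try exact: wint_inH_chebU.
by congr (_ * _); apply: eq_wip => x _; rewrite mulrBl.
Qed.

Lemma cheb_coef_odd f n : inH f -> odd n -> cheb_coef f n = 0.
Proof.
move=> Hf on; rewrite cheb_coefE wip_odd ?mulr0//.
  exact: wint_inH_chebU.
by move=> x Ix; rewrite (inH_even Hf Ix) chebUN -signr_odd on expr1; ring.
Qed.

(** Only [|kern| <= 1] enters, through [wip (kern^2) <= pi / 2], so the bound depends on neither [b]
    nor [xi]. The lower bound is the upper one applied to [-g]. *)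
Lemma wip_kern_le g b xi e : inH g -> 0 <= xi <= 1 -> 0 < e ->
  (forall N, \sum_(n < N) cheb_coef g n ^+ 2 <= e ^+ 2) ->
  `|wip (fun x => g x * kern b xi x)| <= e * (pi / 2).
Proof.
move=> Hg xi01 e0 he.
have [_ _ hb] := bessel_kern b xi01.
have k2 : wip (fun x => kern b xi x ^+ 2) <= pi / 2.
  rewrite -wip1; apply: le_wip.
  - apply: wint_continuous => x; apply: cvgM; exact: continuous_kern.
  - exact: wint_cst.
  - by move=> x _; rewrite -real_normK ?num_real// expr_le1// kern_le1.
have bound f : inH f -> (forall N, \sum_(n < N) cheb_coef f n ^+ 2 <= e ^+ 2) ->
    wip (fun x => f x * kern b xi x) <= e * (pi / 2).
  move=> Hf hf; have := hb f e Hf e0 hf.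
  have := ler_wpM2l (ltW e0) k2; rewrite mulrDr; set p := pi / 2; lra.
rewrite ler_norml bound// andbT lerNl -wipN; last exact: wint_kern.
rewrite (eq_wip (G := fun x => (-1 * g x) * kern b xi x)); last first.
  by move=> x _; rewrite mulN1r mulNr.
apply: bound; first exact: inHZ.
move=> N; apply: le_trans (he N); rewrite le_eqVlt; apply/orP; left; apply/eqP.
by apply: eq_bigr => i _; rewrite cheb_coefZ// mulN1r sqrrN.
Qed.

(** The difference [hk k - f] is paired with the moving kernel and tends to zero by the uniform
    bound. The fixed [f] is paired with [kern (bk k)], where dominated convergence with dominant
    [|f|] handles the change of span. *)
Lemma cvg_wip_kern (bk ek : nat -> R) (hk : nat -> R -> R) b f xi :
  0 <= xi <= 1 -> inH f -> (forall k, inH (hk k)) -> (forall k, 0 < ek k) ->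
  ek k @[k --> \oo] --> 0 -> bk k @[k --> \oo] --> b ->
  (forall k N, \sum_(n < N) (cheb_coef (hk k) n - cheb_coef f n) ^+ 2 <= ek k ^+ 2) ->
  wip (fun x => hk k x * kern (bk k) xi x) @[k --> \oo] --> wip (fun x => f x * kern b xi x).
Proof.
move=> xi01 Hf Hh e0 cek cb hs.
have -> : (fun k => wip (fun x => hk k x * kern (bk k) xi x)) =
   (fun k => wip (fun x => (hk k x - f x) * kern (bk k) xi x) +
             wip (fun x => f x * kern (bk k) xi x)).
  apply/funext => k; rewrite -wipD; [|apply: wint_kern; exact: inHB|exact: wint_kern].
  by apply: eq_wip => x _; ring.
rewrite -[X in _ --> X]add0r; apply: cvgD.
  have ce : ek k * (pi / 2) @[k --> \oo] --> 0.
    by rewrite -(mul0r (pi / 2)); apply: cvgM; [exact: cek|exact: cvg_cst].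
  have bnd k : `|wip (fun x => (hk k x - f x) * kern (bk k) xi x)| <= ek k * (pi / 2).
    apply: wip_kern_le => //; first exact: inHB.
    by move=> N; under eq_bigr do rewrite cheb_coefB//; exact: hs.
  apply/norm_cvg0P.
  apply: (@squeeze_cvgr _ _ _ _ (fun=> 0) (fun k => ek k * (pi / 2))) => //.
    by apply: nearW => k; rewrite normr_ge0 bnd.
  exact: cvg_cst.
apply: (@wip_dct _ _ _ (fun x => `|f x|)).
- move=> n; apply: measurable_funM; [exact: inH_measurable|exact: measurable_kern].
- apply: measurable_funM; [exact: inH_measurable|exact: measurable_kern].
- exact: wint_norm_inH.
- move=> x _; apply: cvgM; first exact: cvg_cst.
  apply: (@cvg_comp _ _ _ (fun k => bk k * pospart (x - xi) / 2) sin _ _ _ _ (@continuous_sin R _)).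
  apply: cvgM; last exact: cvg_cst.
  by apply: cvgM; [exact: cb|exact: cvg_cst].
- by move=> x n _; rewrite normrM ler_piMr// kern_le1.
Qed.

(** Continuity in [xi] gives the integrability over compact intervals required by the weight and
    non-collapse constraints. *)
Lemma continuous_moment b f : inH f -> continuous (moment b f).
Proof.
move=> Hf xi; apply: cvgM; first exact: cvg_cst.
apply: (@continuity_under_integral R _ _ mu (fun xi x => f x * kern b xi x * wgt x)
  I measurable_I11 (xi - 1) (xi + 1) _ _ (fun x => `|f x| * wgt x)).
- by move=> y _; exact: wint_kern.
- apply: aeW => x _ y _; apply: cvgM; last exact: cvg_cst.
  apply: cvgM; first exact: cvg_cst.
  apply: (@continuous_comp _ _ _ (fun xi => b * pospart (x - xi) / 2) sin).
    apply: cvgM; last exact: cvg_cst.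
    apply: cvgM; first exact: cvg_cst.
    apply: (@continuous_comp _ _ _ (fun xi => x - xi) pospart).
      by apply: cvgB; [exact: cvg_cst|exact: cvg_id].
    exact: continuous_pospart.
  exact: continuous_sin.
- exact: wint_norm_inH.
- move=> y _; apply: aeW => x _; rewrite !normrM (ger0_norm (wgt_ge0 x)).
  by rewrite ler_wpM2r ?wgt_ge0// ler_piMr// kern_le1.
- by rewrite inE /= in_itv /=; lra.
Qed.

Lemma integrable_itv_continuous a c F : continuous F -> mu.-integrable `[a, c] (EFin \o F).
Proof.
move=> cF; apply: continuous_compact_integrable; first exact: segment_compact.
exact: continuous_subspaceT.
Qed.

Lemma cvg_Rintegral_itv a c (Fn : nat -> R -> R) F B :
  (forall n, continuous (Fn n)) -> continuous F ->
  (forall x n, a <= x <= c -> `|Fn n x| <= B) ->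
  (forall x, a <= x <= c -> Fn n x @[n --> \oo] --> F x) ->
  \int[mu]_(x in `[a, c]) Fn n x @[n --> \oo] --> \int[mu]_(x in `[a, c]) F x.
Proof.
move=> cFn cF bF hF.
have m0 : measurable (`[a, c]%classic : set R) by exact: measurable_itv.
have iF := integrable_itv_continuous a c cF.
have iB : mu.-integrable `[a, c] (EFin \o (fun=> B)).
  by apply: integrable_itv_continuous => x; exact: cvg_cst.
have [| | | | |_ _ +] := @dominated_convergence _ _ _ mu `[a, c]%classic m0
  (fun n => EFin \o Fn n) (EFin \o F) (EFin \o (fun=> B)).
- by move=> n; case/integrableP : (integrable_itv_continuous a c (cFn n)).
- by case/integrableP : iF.
- apply: aeW => x; rewrite /= in_itv /= => xac.
  by apply: cvg_EFin; [exact: nearW|exact: hF].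
- exact: iB.
- by apply: aeW => x n; rewrite /= in_itv /= => xac; rewrite lee_fin bF.
rewrite -(fineK (integrable_fin_num (mu := mu) m0 iF)) => h.
exact: fine_cvg h.
Qed.

Lemma A2P b0 b f : A2 b0 b f <->
  [/\ 0 < b <= b0, inH f, (drag f < +oo)%E, cheb_coef f 0 = 4 / (pi * b) &
    b * \int[mu]_(xi in `[(0 : R), 1]) `|moment b f xi| <= 1 /\
    (forall xi, 0 <= xi <= 1 -> 0 <= moment b f xi /\
      b ^+ 2 / 4 * \int[mu]_(eta in `[xi, (1 : R)]) (moment b f eta * (eta - xi))
       <= moment b f xi)].
Proof.
have e1 : \int[mu]_(xi in `[(0 : R), 1]) `|bmoment b f xi| =
    \int[mu]_(xi in `[(0 : R), 1]) `|moment b f xi|.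
  by apply: eq_Rintegral => x; rewrite inE /= in_itv /= => /andP[x0 _]; rewrite bmomentE.
have e2 xi : 0 <= xi ->
    \int[mu]_(eta in `[xi, (1 : R)]) (bmoment b f eta * (eta - xi)) =
    \int[mu]_(eta in `[xi, (1 : R)]) (moment b f eta * (eta - xi)).
  move=> xi0; apply: eq_Rintegral => x; rewrite inE /= in_itv /= => /andP[x0 _].
  by rewrite bmomentE// (le_trans xi0).
rewrite /A2 e1; split.
  move=> [h1 [h2 [h3 [h4 [h5 h6]]]]]; split => //; split => // xi xi01.
  have [xi0 _] := andP xi01.
  by have := h6 xi xi01; rewrite (bmomentE _ _ xi0) (e2 _ xi0).
move=> [h1 h2 h3 h4 [h5 h6]].
refine (conj h1 (conj h2 (conj h3 (conj h4 (conj h5 _))))) => xi xi01.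
by have [xi0 _] := andP xi01; rewrite (bmomentE _ _ xi0) (e2 _ xi0); exact: h6.
Qed.

End Moment.

(** * A wing satisfying all constraints *)

Section Admissible.
Context {R : realType}.
Local Notation mu := (@lebesgue_measure R).
Local Notation I := (@I11 R).
Implicit Types (F G f g phi : R -> R) (x y t xi b : R).

(** Lower semicontinuity of the drag rests on this: a uniform bound on finite sums passes to limits
    taken coefficient by coefficient. *)
Lemma drag_leP f (C : R) : (drag f <= (pi / 8 * C)%:E)%E <->
  forall N, \sum_(m < N) (2 * m + 1)%:R * cheb_coef f (2 * m) ^+ 2 <= C.
Proof.
have p8 : 0 < pi / 8 :> R by rewrite divr_gt0// pi_gt0.
have t0 m : (0 <= ((2 * m + 1)%:R * cheb_coef f (2 * m) ^+ 2)%:E)%E.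
  by rewrite lee_fin; apply: mulr_ge0; rewrite ?sqr_ge0 ?ler0n.
rewrite /drag [X in (_ <= X)%E]EFinM lee_pmul2l ?lte_fin//; split=> h.
  move=> N; rewrite -lee_fin; apply: le_trans h.
  rewrite -sumEFin -(big_mkord xpredT (fun m => ((2 * m + 1)%:R * cheb_coef f (2 * m) ^+ 2)%:E)).
  by apply: nneseries_lim_ge => k _ _; exact: t0.
apply: lime_le; first by apply: is_cvg_nneseries => n _ _; exact: t0.
by apply: nearW => n; rewrite big_mkord sumEFin lee_fin.
Qed.

Lemma inH_cst (k : R) : inH (fun=> k).
Proof. by apply/inHP; split => //; exact: (wint_cst (k ^+ 2)). Qed.

Lemma cheb_coef_cst (k : R) n : cheb_coef (fun=> k) n = k * (n == 0%N)%:R.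
Proof.
rewrite cheb_coefE (eq_wip (G := fun x => k * (chebU 0 x * chebU n x))); last first.
  by move=> x _; rewrite /= mul1r.
rewrite wipZ; last first.
  by apply: wint_continuous => x; apply: cvgM; exact: continuous_chebU.
by rewrite wip_chebU eq_sym mulrCA (mulrA (2 / pi)) (mulrC (2 / pi)) pihalfK mul1r.
Qed.

(** For [b <= 1] the angle in the kernel stays in [[0, 1/2]], where sine is nonnegative and
    increasing; the moment [M] is then nonnegative and nonincreasing in [xi]. The lift constraint
    fixes [c] and gives [b / 2 * c = 2 / pi], hence [M <= 1] and the weight constraint. Monotonicity
    bounds the non-collapse integral by [M xi], and [b^2 / 4 <= 1]. *)
Lemma A2_nonempty (b0 : R) : 0 < b0 -> exists b f, A2 b0 b f.
Proof.
move=> b00; pose b := Num.min b0 1.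
have bgt0 : 0 < b by rewrite /b lt_min b00 ltr01.
have b1 : b <= 1 by rewrite /b ge_min lexx orbT.
have bb0 : b <= b0 by rewrite /b ge_min lexx.
clearbody b; pose c := 4 / (pi * b); have pi0 := @pi_gt0 R.
have c0 : 0 < c by rewrite divr_gt0// mulr_gt0.
exists b, (fun=> c).
have Hc := inH_cst c.
pose M := moment b (fun=> c).
have ME xi : M xi = b / 2 * (c * wip (kern b xi)).
  by rewrite /M /moment wipZ//; apply: wint_continuous; exact: continuous_kern.
have iK xi : wint (kern b xi) by apply: wint_continuous; exact: continuous_kern.
have arg xi x : 0 <= xi -> I x -> 0 <= b * pospart (x - xi) / 2 <= 1 / 2.
  move=> xi0 /I11P hx; have p0 := pospart_ge0 (x - xi).
  have p1 : pospart (x - xi) <= 1 by rewrite /pospart ge_max; lra.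
  by apply/andP; split; [rewrite divr_ge0 ?mulr_ge0// ltW|nra].
have pih := @pihalf_ge1 R.
have kern_ge0 xi x : 0 <= xi -> I x -> 0 <= kern b xi x.
  by move=> xi0 Ix; have := arg xi x xi0 Ix => h; apply: sin_ge0_pi; lra.
have bc : b / 2 * c = 2 / pi.
  rewrite /c; move: pi0; generalize (@pi R) => p p0.
  by field; rewrite !gt_eqF.
have ME' xi : M xi = 2 / pi * wip (kern b xi) by rewrite ME mulrA bc.
have M_ge0 xi : 0 <= xi -> 0 <= M xi.
  move=> xi0; rewrite ME' mulr_ge0 ?divr_ge0 ?pi_ge0//.
  by apply: wip_ge0 => x Ix; exact: kern_ge0.
have M_le1 xi : 0 <= xi -> M xi <= 1.
  move=> xi0; rewrite ME' -[leRHS]pihalfK mulrC ler_wpM2r ?divr_ge0 ?pi_ge0//.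
  rewrite -wip1; apply: le_wip => //; first exact: (wint_cst 1).
  by move=> x _; exact: sin_le1.
have M_mono xi eta : 0 <= xi -> xi <= eta -> M eta <= M xi.
  move=> xi0 xe; rewrite !ME' ler_wpM2l ?divr_ge0 ?pi_ge0//.
  apply: le_wip => // x Ix; rewrite /kern.
  have a1 := arg xi x xi0 Ix; have a2 := arg eta x (le_trans xi0 xe) Ix.
  have pm : pospart (x - eta) <= pospart (x - xi).
    by rewrite /pospart ge_max !le_max lexx orbT andbT lerB.
  have : b * pospart (x - eta) / 2 <= b * pospart (x - xi) / 2.
    by rewrite ler_wpM2r// ler_wpM2l// ltW.
  rewrite le_eqVlt => /predU1P[->//|lt]; apply: ltW.
  by rewrite ltr_sin// in_itv /=; lra.
have cM : continuous M by exact: continuous_moment.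
have MB : M = moment b (fun=> c) by [].
clearbody M.
apply/A2P; split => //.
- by rewrite bgt0 bb0.
- apply: (@le_lt_trans _ _ (pi / 8 * c ^+ 2)%:E); last exact: ltry.
  apply/drag_leP => N; case: N => [|N]; first by rewrite big_ord0 sqr_ge0.
  rewrite big_ord_recl big1 => [|i _]; last first.
    by rewrite cheb_coef_cst mulr0 expr0n mulr0.
  by rewrite cheb_coef_cst mulr1 addr0 mul1r.
- by rewrite cheb_coef_cst mulr1.
have i01 a : mu.-integrable `[a, (1 : R)] (EFin \o (fun x => `|M x|)).
  by apply: integrable_itv_continuous => x; apply: cvg_norm; exact: cM.
have icst a (k : R) : mu.-integrable `[a, (1 : R)] (EFin \o (fun=> k)).
  by apply: integrable_itv_continuous => x; exact: cvg_cst.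
have int_cst (a k : R) : 0 <= a <= 1 -> 0 <= k -> \int[mu]_(x in `[a, (1 : R)]) k <= k.
  move=> a01 k0; rewrite Rintegral_cst//= lebesgue_measure_itv /= lte_fin.
  by case: ifPn => a1 /=; rewrite ?mulr0// ler_piMr//; lra.
split.
  have h : \int[mu]_(xi in `[(0 : R), 1]) `|M xi| <= 1.
    apply: le_trans (int_cst 0 1 _ _); rewrite ?lexx ?ler01//.
    apply: le_Rintegral => // x; rewrite /= in_itv /= => /andP[x0 _].
    by rewrite ger0_norm ?M_ge0// M_le1.
  by rewrite -MB; apply: le_trans (ler_wpM2l (ltW bgt0) h) _; rewrite mulr1.
move=> xi xi01; have [xi0 xi1] := andP xi01; rewrite -MB.
split; first exact: M_ge0.
have h : \int[mu]_(eta in `[xi, (1 : R)]) (M eta * (eta - xi)) <= M xi.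
  apply: le_trans (int_cst xi (M xi) _ _) => //; last exact: M_ge0.
  apply: le_Rintegral => //.
    apply: integrable_itv_continuous => x; apply: cvgM; first exact: cM.
    by apply: cvgB; [exact: cvg_id|exact: cvg_cst].
  move=> x; rewrite /= in_itv /= => /andP[x0 x1].
  apply: le_trans (M_mono xi x xi0 x0); rewrite ler_piMr//; last by lra.
  exact: M_ge0 (le_trans xi0 x0).
have b20 : 0 <= b ^+ 2 / 4 by rewrite divr_ge0 ?sqr_ge0.
apply: le_trans (ler_wpM2l b20 h) _; rewrite ler_piMl ?M_ge0//.
by rewrite ler_pdivrMr// mul1r (@le_trans _ _ 1) ?ler1n// expr_le1// ltW.
Qed.

End Admissible.

(** * Passage to the limit *)

Section Compactness.
Context {R : realType}.
Implicit Types (a g : nat -> R).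

(** A cluster point in the compact product replaces diagonal extraction: finitely many coordinates
    cut out a neighbourhood, which the sequence meets at some index beyond [k]. The choice [s] need
    not be increasing; [k <= s k] is enough. *)
Lemma subsequence_coordinatewise (a : nat -> nat -> R) (B : R) :
  (forall n m, `|a n m| <= B) ->
  exists (l : nat -> R) (s : nat -> nat), forall k, (k <= s k)%N /\
    forall m, (m <= k)%N -> `|a (s k) m - l m| < k.+1%:R^-1.
Proof.
move=> aB.
have cK := @tychonoff nat (fun _ => R) (fun _ => `[- B, B]%classic)
  (fun _ => @segment_compact R (- B) B).
have [|l [_ cl]] := cK (fmap a \oo) _.
  exists 0%N => // n _ i; rewrite /= in_itv /= -ler_norml; exact: aB.
exists l.
pose P := prod_topology (fun _ : nat => R).
have FP : Filter (nbhs (l : P)) by exact: (@nbhs_filter P l).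
have nl k j : \forall x \near (l : P), forall m, (m < j)%N -> `|x m - l m| < k.+1%:R^-1.
  elim: j => [|j ih]; first by apply: (@filterS _ _ FP _ _ _ filterT) => x _ m.
  have pj : \forall x \near (l : P), `|x j - l j| < k.+1%:R^-1.
    have := @proj_continuous nat (fun _ => R) j l => /cvgrPdist_lt.
    move=> /(_ k.+1%:R^-1); rewrite invr_gt0 ltr0n => /(_ isT).
    by apply: (@filterS _ _ FP) => x; rewrite distrC.
  apply: (@filterS2 _ _ FP _ _ _ _ ih pj) => x h1 h2 m; rewrite ltnS leq_eqVlt => /predU1P[->//|].
  exact: h1.
have ex k : exists n, (k <= n)%N /\ forall m, (m <= k)%N -> `|a n m - l m| < k.+1%:R^-1.
  have [|x [[n kn <-] h]] := cl (a @` [set n | (k <= n)%N]) _ _ (nl k k.+1).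
    by exists k => // n kn; exists n.
  by exists n; split.
have [s hs] := choice ex.
by exists s.
Qed.

Lemma sum_even_support g M : (forall n, odd n -> g n = 0) ->
  \sum_(n < 2 * M) g n = \sum_(m < M) g (2 * m)%N.
Proof.
move=> g0; elim: M => [|M ih]; first by rewrite muln0 !big_ord0.
rewrite mulnS add2n !big_ord_recr /= ih (g0 (2 * M).+1) ?addr0//.
by rewrite /= oddM.
Qed.

Lemma sum_even_support_le g N M : (forall n, 0 <= g n) -> (forall n, odd n -> g n = 0) ->
  (N <= 2 * M)%N -> \sum_(n < N) g n <= \sum_(m < M) g (2 * m)%N.
Proof.
move=> gpos g0 NM; rewrite -sum_even_support//.
rewrite (big_ord_widen _ (fun n => g n) NM) [leRHS](bigID (fun i : 'I__ => (i < N)%N)) /=.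
by rewrite lerDl sumr_ge0.
Qed.

(** The minimum with [N] serves the induction; the count [k.+1] of head coefficients is what is
    wanted. *)
Lemma sum_leq_indicator N k : (\sum_(m < N) (m <= k) <= minn N k.+1)%N.
Proof.
elim: N => [|n ih]; first by rewrite big_ord0.
rewrite big_ord_recr /=; apply: (leq_trans (leq_add ih (leqnn _))).
have [nk|nk] := leqP n k.
  by rewrite (minn_idPl (leqW nk)) (minn_idPl (nk : n.+1 <= k.+1)%N) addn1.
by rewrite (minn_idPr nk) (minn_idPr (leqW nk)) addn0.
Qed.

End Compactness.

(** * Stability of the constraints and of the drag bound along the sequence *)

Section Limit.
Context {R : realType}.
Local Notation mu := (@lebesgue_measure R).

Variables (b0 d : R) (bk : nat -> R) (hk : nat -> R -> R) (l : nat -> R).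
Hypothesis Ak : forall k, A2 b0 (bk k) (hk k).
Hypothesis Ck : forall k N,
  \sum_(m < N) (2 * m + 1)%:R * cheb_coef (hk k) (2 * m) ^+ 2 <= d + k.+1%:R^-1.
Hypothesis lk : forall k m, (m <= k)%N -> `|cheb_coef (hk k) (2 * m) - l m| < k.+1%:R^-1.

Let inHk k : inH (hk k).
Proof. by case: (Ak k) => _ []. Qed.

Let cvg_inv : k.+1%:R^-1 @[k --> \oo] --> (0 : R).
Proof. exact: (@cvg_harmonic R). Qed.

Let cvg_l m : cheb_coef (hk k) (2 * m) @[k --> \oo] --> l m.
Proof.
apply/cvgrPdist_lt => e e0.
have := cvg_inv => /cvgrPdist_lt /(_ e e0) h.
near=> k; have := @lk k m => /(_ _); rewrite distrC => /(_ _)/lt_trans; apply.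
  by near: k; exists m.
by near: k; apply: filterS h => k; rewrite sub0r normrN ger0_norm ?invr_ge0.
Unshelve. all: by end_near. Qed.

Let l_sum N : \sum_(m < N) (2 * m + 1)%:R * l m ^+ 2 <= d.
Proof.
have cd : d + k.+1%:R^-1 @[k --> \oo] --> d.
  by rewrite -[X in _ --> X]addr0; apply: cvgD; [exact: cvg_cst|exact: cvg_inv].
apply: (@ler_cvg_seq R _ _ _ _ _ cd (Ck ^~ N)).
elim: N => [|N ih].
  rewrite big_ord0; under eq_fun do rewrite big_ord0; exact: cvg_cst.
rewrite big_ord_recr /=; under eq_fun do rewrite big_ord_recr /=.
apply: cvgD => //; apply: cvgM; first exact: cvg_cst.
by apply: cvgM; exact: cvg_l.
Qed.

Let d_ge0 : 0 <= d.
Proof. by have := l_sum 0; rewrite big_ord0. Qed.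

Let c n := if odd n then 0 else l n./2.

Let c_even m : c (2 * m) = l m.
Proof. by rewrite /c mul2n odd_double doubleK. Qed.

Let c_odd n : odd n -> c n = 0.
Proof. by rewrite /c => ->. Qed.

(** For [n = 2m] the weight [n.+1] is exactly the drag weight [2m + 1], so finite drag is the
    hypothesis of [riesz_fischer]. *)
Let c_sum N : \sum_(n < N) n.+1%:R * c n ^+ 2 <= d.
Proof.
apply: le_trans (l_sum N).
apply: (le_trans (@sum_even_support_le R (fun n => n.+1%:R * c n ^+ 2) N N _ _ _)).
- by move=> n; rewrite mulr_ge0 ?sqr_ge0.
- by move=> n /c_odd ->; rewrite expr0n mulr0.
- by rewrite leq_pmull.
- by apply: ler_sum => i _; rewrite c_even addn1.
Qed.

Let inv_le1 k : k.+1%:R^-1 <= 1 :> R.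
Proof. by rewrite invf_le1 ?ler1n ?ltr0n. Qed.

Let E : R := 1 + 4 * (d + 1).

Let E_gt0 : 0 < E.
Proof. by have h := d_ge0; rewrite /E; lra. Qed.

(** The [k+1] head terms are each below [(k+1)^-2]. In the tail the drag weight exceeds [k+1], so
    the two drag bounds leave at most [2 (2d + 1) / (k+1)]. The total [(4d + 3) / (k+1)] is absorbed
    by [E]. *)
Let coef_dist k N : \sum_(n < N) (cheb_coef (hk k) n - c n) ^+ 2 <= E / k.+1%:R.
Proof.
pose x m := cheb_coef (hk k) (2 * m).
have k0 : 0 < k.+1%:R :> R by rewrite ltr0n.
apply: (le_trans (@sum_even_support_le R (fun n => (cheb_coef (hk k) n - c n) ^+ 2) N N _ _ _)).
- by move=> n; exact: sqr_ge0.
- by move=> n on; rewrite c_odd// cheb_coef_odd// subrr expr0n.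
- by rewrite leq_pmull.
(* A single majorant for both ranges: the first term serves [m <= k], the second [m > k], through
   [(x - l)^2 <= 2 (x^2 + l^2)] and [k + 1 <= 2m + 1]. *)
pose T (m : nat) := (m <= k)%N%:R / k.+1%:R ^+ 2 +
  2 / k.+1%:R * ((2 * m + 1)%:R * x m ^+ 2 + (2 * m + 1)%:R * l m ^+ 2).
apply: (@le_trans _ _ (\sum_(m < N) T m)).
  apply: ler_sum => m _; rewrite c_even -/(x m) /T.
  have w0 : 0 <= (2 * m + 1)%:R * x m ^+ 2 + (2 * m + 1)%:R * l m ^+ 2.
    by rewrite addr_ge0// mulr_ge0 ?sqr_ge0.
  case: leqP => mk.
    rewrite -[leLHS]addr0; apply: lerD; last first.
      by rewrite mulr_ge0// divr_ge0// ltW.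
    rewrite mul1r -exprVn -[leLHS]real_normK ?num_real// ler_sqr ?nnegrE ?invr_ge0//.
    exact: ltW (lk mk).
  rewrite mul0r add0r -mulrDr mulrA.
  apply: (@le_trans _ _ (2 * (x m ^+ 2 + l m ^+ 2))).
    by have := sqr_ge0 (x m + l m); lra.
  rewrite ler_wpM2r ?addr_ge0 ?sqr_ge0//.
  rewrite -mulrA ler_peMr// ler_pdivlMl// mulr1 ler_nat.
  by rewrite addn1 ltnS (leq_trans (ltnW mk))// leq_pmull.
rewrite big_split /= -mulr_suml -mulr_sumr big_split /=.
have s1 : \sum_(m < N) (m <= k)%N%:R <= k.+1%:R :> R.
  by rewrite -natr_sum ler_nat (leq_trans (sum_leq_indicator N k))// geq_minr.
have s2 := Ck k N; have s3 := l_sum N.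
apply: (@le_trans _ _ (k.+1%:R / k.+1%:R ^+ 2 + 2 / k.+1%:R * ((d + 1) + d))).
  apply: lerD; first by rewrite ler_wpM2r// invr_ge0 exprn_ge0// ltW.
  have w2 : 0 <= 2 / k.+1%:R :> R by rewrite divr_ge0// ltW.
  rewrite ler_wpM2l//; apply: lerD => //.
  by apply: (le_trans s2); rewrite lerD2l.
rewrite expr2 invfM mulrA divff ?gt_eqF// mul1r /E.
have y0 : 0 <= k.+1%:R^-1 :> R by rewrite invr_ge0.
by move: (k.+1%:R^-1) y0 => y y0; nra.
Qed.

Let e k : R := Num.sqrt (E / k.+1%:R).

Let e_gt0 k : 0 < e k.
Proof. by rewrite sqrtr_gt0 divr_gt0// ltr0n. Qed.

Let cvg_e : e k @[k --> \oo] --> 0.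
Proof.
rewrite /e -[X in _ --> X]sqrtr0.
apply: (@cvg_comp _ _ _ (fun k => E / k.+1%:R) Num.sqrt _ _ _ _ (@sqrt_continuous R _)).
by rewrite -(mulr0 E); apply: cvgM; [exact: cvg_cst|exact: cvg_inv].
Qed.

Lemma A2_limit : exists b f, A2 b0 b f /\ (drag f <= (pi / 8 * d)%:E)%E.
Proof.
have pi0 := @pi_gt0 R.
have [f [Hf cf]] := riesz_fischer c_odd c_sum.
have hk0 k : cheb_coef (hk k) 0%N = 4 / (pi * bk k) by case: (Ak k) => _ [_ [_ []]].
have bk0 k : 0 < bk k by case: (Ak k) => /andP[].
have bk_le k : bk k <= b0 by case: (Ak k) => /andP[].
have b0_gt0 : 0 < b0 by exact: lt_le_trans (bk_le 0).
(* The upper limit [b0] on the span keeps the zeroth coefficient away from zero, so the lift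
   constraint can be solved for the limit span [b]. *)
have l0 : 4 / (pi * b0) <= l 0%N.
  apply: (cvg_seq_ge (@cvg_l 0%N)) => k.
  rewrite muln0 hk0 ler_wpM2l// lef_pV2 ?posrE ?mulr_gt0//.
  by rewrite ler_wpM2l// ltW.
have l0_gt0 : 0 < l 0%N by apply: lt_le_trans l0; rewrite divr_gt0// mulr_gt0.
pose b := 4 / (pi * l 0%N).
have b_gt0 : 0 < b by rewrite divr_gt0// mulr_gt0.
have inv_inv (y : R) : 0 < y -> 4 / (pi * (4 / (pi * y))) = y.
  by move=> y0; move: pi0; generalize (@pi R) => p p0; field; rewrite !gt_eqF.
have cb : bk k @[k --> \oo] --> b.
  have -> : bk = (fun k => 4 / (pi * cheb_coef (hk k) (2 * 0)%N)).
    by apply/funext => k; rewrite muln0 hk0 inv_inv.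
  apply: cvgM; first exact: cvg_cst.
  apply: cvgV; first by rewrite gt_eqF// mulr_gt0.
  by apply: cvgM; [exact: cvg_cst|exact: cvg_l].
have b_le : b <= b0.
  exact: (cvg_seq_le cb bk_le).
have e2 k N : \sum_(n < N) (cheb_coef (hk k) n - cheb_coef f n) ^+ 2 <= e k ^+ 2.
  under eq_bigr do rewrite cf.
  by rewrite sqr_sqrtr ?coef_dist// divr_ge0 ?ltW.
have cM xi : 0 <= xi <= 1 -> moment (bk k) (hk k) xi @[k --> \oo] --> moment b f xi.
  move=> xi01; apply: cvgM.
    by apply: cvgM; [exact: cb|exact: cvg_cst].
  exact: (cvg_wip_kern xi01 Hf inHk e_gt0 cvg_e cb e2).
(* The squared coefficients sum to at most [d + 1 <= (d + 2)^2], so [wip_kern_le] applies with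
   [e = d + 2] and no square root is needed. *)
pose B := b0 / 2 * ((d + 2) * (pi / 2)).
have M_le k xi : 0 <= xi <= 1 -> `|moment (bk k) (hk k) xi| <= B.
  move=> xi01; rewrite normrM; apply: ler_pM => //.
    have bk2 : 0 <= bk k / 2 by rewrite divr_ge0// ltW.
    by rewrite ger0_norm// ler_wpM2r.
  apply: wip_kern_le => //; first by rewrite ltr_wpDl.
  move=> N; apply: (@le_trans _ _ (d + 1)); last by have d0 := d_ge0; nra.
  apply: (@le_trans _ _ (d + k.+1%:R^-1)); last by rewrite lerD2l inv_le1.
  apply: le_trans (Ck k N).
  apply: (le_trans (@sum_even_support_le R (fun n => cheb_coef (hk k) n ^+ 2) N N _ _ _)).
  - by move=> n; exact: sqr_ge0.
  - by move=> n on; rewrite cheb_coef_odd// expr0n.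
  - by rewrite leq_pmull.
  - by apply: ler_sum => i _; rewrite ler_peMl ?sqr_ge0// addn1 ler1n.
have contM k : continuous (moment (bk k) (hk k)) by exact: continuous_moment.
have contMf : continuous (moment b f) by exact: continuous_moment.
exists b, f; split; last first.
  by apply/drag_leP => N; under eq_bigr do rewrite cf c_even; exact: l_sum.
apply/A2P; split.
- by rewrite b_gt0.
- exact: Hf.
- apply: (@le_lt_trans _ _ (pi / 8 * d)%:E); last exact: ltry.
  by apply/drag_leP => N; under eq_bigr do rewrite cf c_even; exact: l_sum.
- by rewrite cf -[0%N](muln0 2) c_even inv_inv.
split.
  apply: (@cvg_seq_le R (fun k => bk k *
    \int[mu]_(xi in `[(0 : R), 1]) `|moment (bk k) (hk k) xi|)).
  - apply: cvgM; first exact: cb.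
    apply: (@cvg_Rintegral_itv _ _ _ _ _ B).
    + by move=> k x; apply: cvg_norm; exact: contM.
    + by move=> x; apply: cvg_norm; exact: contMf.
    + by move=> x k x01; rewrite normr_id M_le.
    + by move=> x x01; apply: cvg_norm; exact: cM.
  - by move=> k; have /A2P[_ _ _ _ []] := Ak k.
move=> xi xi01; have [xi0 xi1] := andP xi01.
split.
  apply: (cvg_seq_ge (cM xi xi01)) => k.
  by have /A2P[_ _ _ _ [_ /(_ xi xi01)[]]] := Ak k.
apply: (ler_cvg_seq _ (cM xi xi01)); last first.
  by move=> k; have /A2P[_ _ _ _ [_ /(_ xi xi01)[_ h]]] := Ak k; exact: h.
apply: cvgM.
  by apply: cvgM; [apply: cvgM; exact: cb|exact: cvg_cst].
apply: (@cvg_Rintegral_itv _ _ _ _ _ B).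
- move=> k x; apply: cvgM; first exact: contM.
  by apply: cvgB; [exact: cvg_id|exact: cvg_cst].
- move=> x; apply: cvgM; first exact: contMf.
  by apply: cvgB; [exact: cvg_id|exact: cvg_cst].
- move=> x k /andP[x0 x1]; rewrite normrM -[leRHS]mulr1.
  apply: ler_pM => //; first by apply: M_le; lra.
  by rewrite ger0_norm; lra.
- move=> x /andP[x0 x1]; apply: cvgM; first by apply: cM; lra.
  exact: cvg_cst.
Qed.

End Limit.

(** * Minimising sequence and conclusion *)

Lemma drag_fin {R : realType} (f : R -> R) : (drag f < +oo)%E ->
  exists2 r, 0 <= r & drag f = (pi / 8 * r)%:E.
Proof.
have p8 : 0 < pi / 8 :> R by rewrite divr_gt0// pi_gt0.
move=> fin; have d0 : (0 <= drag f)%E.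
  rewrite /drag mule_ge0 ?lee_fin ?(ltW p8)//; apply: nneseries_ge0 => n _ _.
  by rewrite lee_fin; apply: mulr_ge0; rewrite ?sqr_ge0 ?ler0n.
have fn : drag f \is a fin_num by rewrite ge0_fin_numE.
exists ((pi / 8)^-1 * fine (drag f)).
  by rewrite mulr_ge0 ?fine_ge0// invr_ge0 ltW.
by rewrite mulrA divff ?gt_eqF// mul1r fineK.
Qed.

Unset Implicit Arguments.

Theorem theorem4p1 (R : realType) (b0 : R) (hb0 : 0 < b0) :
  exists (bt : R) (ft : R -> R),
    A2 b0 bt ft /\
    (forall (b : R) (f : R -> R), A2 b0 b f -> (drag ft <= drag f)%E).
Proof.
pose E := [set r | exists b f, [/\ A2 b0 b f, 0 <= r & drag f = (pi / 8 * r)%:E]].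
have inE b f : A2 b0 b f -> exists2 r, E r & drag f = (pi / 8 * r)%:E.
  move=> A; have [_ [_ [/drag_fin[r r0 dr] _]]] := A.
  by exists r => //; exists b, f.
have hE : has_inf E.
  split; last by exists 0 => r [b [f []]].
  by have [b [f /inE[r Er _]]] := A2_nonempty hb0; exists r.
have seqE k : exists bf : R * (R -> R), A2 b0 bf.1 bf.2 /\
    (drag bf.2 <= (pi / 8 * (inf E + k.+1%:R^-1))%:E)%E.
  have [|r [b [f [A _ dr]]] rlt] := @inf_adherent _ E k.+1%:R^-1 _ hE.
    by rewrite invr_gt0 ltr0n.
  exists (b, f); split => //=; rewrite dr lee_fin ler_wpM2l ?(ltW rlt)//.
  by rewrite divr_ge0 ?pi_ge0.
have [s sP] := choice seqE.
pose a n m := cheb_coef (s n).2 (2 * m).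
have sum_s n N : \sum_(m < N) (2 * m + 1)%:R * a n m ^+ 2 <= inf E + n.+1%:R^-1.
  by have [_ /drag_leP] := sP n; exact.
have inv_le1 (k : nat) : k.+1%:R^-1 <= 1 :> R.
  by rewrite invf_le1 ?ler1n ?ltr0n.
have E0 : 0 <= inf E by apply: lb_le_inf; [case: hE|move=> r [b [f []]]].
(* Each squared coefficient is at most [inf E + 1], which is below [(inf E + 2)^2]; this gives one
   compact interval for all coordinates. *)
have a_le n m : `|a n m| <= inf E + 2.
  have a2 : a n m ^+ 2 <= inf E + 1.
    apply: (@le_trans _ _ (inf E + n.+1%:R^-1)); last by rewrite lerD2l.
    apply: le_trans (sum_s n m.+1); rewrite big_ord_recr /=.
    apply: (@le_trans _ _ ((2 * m + 1)%:R * a n m ^+ 2)).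
      by rewrite ler_peMl ?sqr_ge0// addn1 ler1n.
    by rewrite lerDr sumr_ge0// => i _; rewrite mulr_ge0 ?sqr_ge0.
  rewrite -(@ler_pXn2r _ 2)// ?nnegrE ?addr_ge0//.
  by rewrite real_normK ?num_real//; move: (inf E) E0 a2 => d; nra.
have [l [t lt]] := subsequence_coordinatewise a_le.
have [|k N|k m mk|b [f [A df]]] :=
  @A2_limit R b0 (inf E) (fun k => (s (t k)).1) (fun k => (s (t k)).2) l.
- by move=> k; have [] := sP (t k).
(* Since [k <= t k], the selected term is at least as close to the infimum as the index [k]
   demands. *)
- apply: (le_trans (sum_s (t k) N)); rewrite lerD2l lef_pV2 ?posrE ?ltr0n// ler_nat.
  by have [] := lt k.
- by have [_] := lt k; exact.
exists b, f; split=> // b' f' /inE[r Er ->]; apply: (le_trans df).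
rewrite lee_fin ler_wpM2l ?divr_ge0 ?pi_ge0//.
by apply: ge_inf => //; case: hE.
Qed.
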